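(* Assume (A2) and (A3), and consider parameter values $(\eta,\sigma^2,b,d)$ for which $\rho<0$, so that the tail-index $\alpha$ (the unique $\alpha>0$ with $h(\alpha)=1$) is defined. Then: the tail-index $\alpha$ is strictly increasing in the batch-size $b$ and strictly decreasing in the stepsize $\eta$ and in the variance $\sigma^2$, provided that $\alpha\ge 1$; moreover, $\alpha$ is strictly decreasing in the dimension $d$.
   Context: Setup: integers $d,b\ge1$, stepsize $\eta>0$, i.i.d. data $(a_i,y_i)$ with $a_i\in\mathbb{R}^d$, $y_i\in\mathbb{R}$; $H_k=\sum_{i=b(k-1)+1}^{bk}a_ia_i^T$, $M_k=I_d-\frac{\eta}{b}H_k$, $q_k=\frac{\eta}{b}\sum_{i=b(k-1)+1}^{bk}a_iy_i$, SGD iterates $x_k=M_kx_{k-1}+q_k$. $\|\cdot\|$ is the Euclidean/spectral norm. $\Pi_k=M_k\cdots M_1$, $h(s)=\lim_{k\to\infty}(\mathbb{E}\|\Pi_k\|^s)^{1/k}$, $\rho=\lim_{k\to\infty}(2k)^{-1}\log\lambda_{\max}(\Pi_k^T\Pi_k)$. Assumptions: (A2) $y_i$ i.i.d. with continuous density supported on $\mathbb{R}$, all moments finite. (A3) $a_i\sim\mathcal{N}(0,\sigma^2I_d)$ i.i.d. Under these assumptions and $\rho<0$ there is a unique $\alpha>0$ with $h(\alpha)=1$, called the tail-index. *)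

(* Defs.v *)
From HB Require Import structures.
From mathcomp Require Import all_boot all_order all_algebra.
From mathcomp Require Import all_classical all_reals all_analysis.
Set Implicit Arguments. Unset Strict Implicit. Unset Printing Implicit Defensive.
Import Order.TTheory GRing.Theory Num.Theory.
Import numFieldNormedType.Exports.
Local Open Scope classical_set_scope.
Local Open Scope ring_scope.

Definition iid_std_normal {R : realType} {dT : measure_display}
  {T : measurableType dT} (P : probability T R) (Z : nat -> nat -> T -> R) :=
  [/\ (forall i j, measurable_fun setT (Z i j)),
      (forall i j (A : set R), measurable A ->
          P (Z i j @^-1` A) = normal_prob 0 1 A) &
      (forall (s : seq (nat * nat)) (B : nat * nat -> set R),
          uniq s -> (forall p, measurable (B p)) ->
          P (\bigcap_(p in [set` s]) (Z p.1 p.2 @^-1` B p)) =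
          (\prod_(p <- s) P (Z p.1 p.2 @^-1` B p))%E)].

(* The SGD model: a_i = sqrt(var) * (Z i 0, ..., Z i (d-1))  ~ N(0, var I_d) *)
(* batches are 0-based: batch k (k >= 1) uses samples b(k-1) <= i < bk     *)
Section Model.
Context {R : realType} {dT : measure_display} {T : measurableType dT}.
Variable Z : nat -> nat -> T -> R.

Definition avec (var : R) (d : nat) (i : nat) (w : T) : 'cV[R]_d :=
  \col_(j < d) (Num.sqrt var * Z i j w).

Definition Hmat (var : R) (b d k : nat) (w : T) : 'M[R]_d :=
  \sum_(b * (k - 1) <= i < b * k) (avec var d i w *m (avec var d i w)^T).

Definition Mmat (eta var : R) (b d k : nat) (w : T) : 'M[R]_d :=
  1%:M - (eta / b%:R) *: Hmat var b d k w.

Fixpoint Pimat (eta var : R) (b d k : nat) (w : T) : 'M[R]_d :=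
  match k with
  | 0 => 1%:M
  | k'.+1 => Mmat eta var b d k'.+1 w *m Pimat eta var b d k' w
  end.
End Model.

Definition vnorm {R : realType} {d : nat} (v : 'cV[R]_d) : R :=
  Num.sqrt (\sum_(j < d) (v j 0) ^+ 2).

Definition spec_norm {R : realType} {d : nat} (A : 'M[R]_d) : R :=
  sup [set vnorm (A *m v) | v in [set v : 'cV[R]_d | vnorm v <= 1]].

Definition lambda_max {R : realType} {d : nat} (A : 'M[R]_d) : R :=
  sup [set a : R | eigenvalue A a].

Definition hseq {R : realType} {dT : measure_display} {T : measurableType dT}
  (P : probability T R) (Z : nat -> nat -> T -> R)
  (eta var : R) (b d : nat) (s : R) (k : nat) : \bar R :=
  poweR (\int[P]_w (powR (spec_norm (Pimat Z eta var b d k w)) s)%:E)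
        (k%:R)^-1.

Definition h_is {R : realType} {dT : measure_display} {T : measurableType dT}
  (P : probability T R) (Z : nat -> nat -> T -> R)
  (eta var : R) (b d : nat) (s : R) (l : R) : Prop :=
  hseq P Z eta var b d s @ \oo --> l%:E.

Definition rho_is {R : realType} {dT : measure_display} {T : measurableType dT}
  (P : probability T R) (Z : nat -> nat -> T -> R)
  (eta var : R) (b d : nat) (r : R) : Prop :=
  {ae P, forall w,
     (fun k : nat => ((2 * k)%:R)^-1 *
        ln (lambda_max ((Pimat Z eta var b d k w)^T *m Pimat Z eta var b d k w)))
     @ \oo --> r}.

Definition rho_negative {R : realType} {dT : measure_display} {T : measurableType dT}
  (P : probability T R) (Z : nat -> nat -> T -> R)
  (eta var : R) (b d : nat) : Prop :=
  exists r : R, r < 0 /\ rho_is P Z eta var b d r.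

Definition tail_index {R : realType} {dT : measure_display} {T : measurableType dT}
  (P : probability T R) (Z : nat -> nat -> T -> R)
  (eta var : R) (b d : nat) (alpha : R) : Prop :=
  0 < alpha /\ h_is P Z eta var b d alpha 1.

(* Main.v *)
(* Put c = eta * var / b.  By rotation invariance of the Gaussian law, the
   one-step growth E ||M v||^s equals ||v||^s m(c, d, b, s), where
   m = E ||M e_0||^s does not depend on v; conditioning on the past gives
   E ||Pi_k v||^s = ||v||^s m^k, so E ||Pi_k||^s lies between m^k and a constant
   multiple of m^k, and h(s) = 1 forces m(c, d, b, s) = 1.
   Monotonicity is then read off from m.  In c: M e_0 is affine in c and equals
   e_0 at c = 0, so strict convexity of c |-> m gives m(c1) < 1 when c1 < c2 and
   m(c2) = 1.  In b: M for b + 1 samples is the average of its b + 1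
   leave-one-out versions, so m strictly decreases by convexity.  In d:
   ||M e_0||^2 gains an almost surely positive term for each extra coordinate.
   Finally E X < 1 implies E X^t < 1 for 0 < t <= 1, so m(s) < 1 puts the
   tail-index strictly to the right of s. *)

Require Import Defs.
From HB Require Import structures.
From mathcomp Require Import all_boot all_order all_algebra.
From mathcomp Require Import all_classical all_reals all_analysis.
From mathcomp Require Import measurable_realfun.
From mathcomp Require Import ring lra zify.
Import Order.TTheory GRing.Theory Num.Theory.
Import numFieldNormedType.Exports.
Set Implicit Arguments.
Unset Strict Implicit.
Unset Printing Implicit Defensive.
Local Open Scope classical_set_scope.
Local Open Scope ring_scope.

(** Conditioning and invariance are both treated as equality in law. An i.i.d. family induces a law
    on path space that is determined by finite rectangles, so an expectation may be recomputed on
    any other i.i.d. family: a product space for independence, a rotated pair of entries for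
    isotropy. Rotations in the planes of coordinates 0 and [n] suffice, since successive ones carry
    any vector to a multiple of e_0. All integrands are nonnegative and integrals live in the
    extended reals, so Tonelli applies without a prior moment bound; finiteness of m is drawn from
    h(s) = 1 itself. Strictness avoids the equality cases of convexity: it is enough to exhibit a
    box of Gaussian entries, of positive probability, on which two of the averaged vectors have
    e_0-coordinates of opposite sign. The condition alpha >= 1 enters where x^s must be convex. *)

Lemma measurable_bigcap_seq {d} {T : measurableType d} (I : choiceType)
  (s : seq I) (F : I -> set T) :
  (forall i, measurable (F i)) -> measurable (\bigcap_(i in [set` s]) F i).
Proof.
by move=> mF; rewrite bigcap_seq; apply: big_ind => // *; exact: measurableI.
Qed.

(** * Laws of i.i.d. Gaussian families *)

Section Rects.
Context {R : realType}.

Definition rect (s : seq (nat * nat)) (B : nat * nat -> set R) :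
  set (nat -> nat -> R) := \bigcap_(p in [set` s]) [set u | B p (u p.1 p.2)].

Definition rects : set (set (nat -> nat -> R)) :=
  [set A | exists s B, [/\ uniq s, forall p, measurable (B p) & A = rect s B]].

End Rects.

(* [nat -> nat -> R] with the cylinder sigma-algebra. *)
Notation pathT R := (g_sigma_algebraType (@rects R)).

Section Law.
Context {R : realType}.

Lemma rects_setI : setI_closed (@rects R).
Proof.
move=> _ _ [s [B [us mB ->]]] [t [C [ut mC ->]]].
(* Each constraint is padded with [setT] off its own list, so that the two lists can be merged. *)
pose D p := (if p \in s then B p else setT) `&` (if p \in t then C p else setT).
exists (undup (s ++ t)), D; split; first exact: undup_uniq.
  by move=> p; apply: measurableI; case: ifP.
rewrite predeqE => u; split => [[Bu Cu] p /= _|Du].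
  by split; case: ifPn => // ps; [exact: Bu|exact: Cu].
split => p /= ps; have := Du p; rewrite /= mem_undup mem_cat ps ?orbT => /(_ isT) [].
  by rewrite ps.
by rewrite ps.
Qed.

Lemma measurable_coord i j :
  measurable_fun setT (fun u : pathT R => u i j).
Proof.
move=> _ A mA; rewrite setTI; apply: sub_sigma_algebra.
exists [:: (i, j)], (fun=> A); split => //.
rewrite predeqE => u; split => [Au p|]; first by rewrite /= inE => /eqP ->.
by move=> h; apply: (h (i, j)); rewrite /= inE.
Qed.

Lemma path_process_measurable {dT} {T : measurableType dT} (Z : nat -> nat -> T -> R) :
  (forall i j, measurable_fun setT (Z i j)) ->
  measurable_fun setT (fun w => (fun i j => Z i j w) : pathT R).
Proof.
move=> mZ; apply: (@measurability _ _ _ (pathT R) _ _ (@rects R)) => //.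
move=> _ [_ [s [B [us mB ->]]] <-]; rewrite setTI.
rewrite [X in measurable X](_ : _ =
  \bigcap_(p in [set` s]) (Z p.1 p.2 @^-1` B p)); last by [].
apply: measurable_bigcap_seq => p.
rewrite -[X in measurable X]setTI; exact: mZ.
Qed.

(** Both families push forward to measures that take the same product value on [rects], a pi-system
    generating the sigma-algebra. Every later symmetry is obtained by exhibiting a second i.i.d.
    family. *)
Lemma iid_law_unique {d1 d2} {T1 : measurableType d1} {T2 : measurableType d2}
  (P1 : probability T1 R) (P2 : probability T2 R)
  (Z1 : nat -> nat -> T1 -> R) (Z2 : nat -> nat -> T2 -> R)
  (F : pathT R -> \bar R) :
  iid_std_normal P1 Z1 -> iid_std_normal P2 Z2 ->
  measurable_fun setT F -> (forall u, 0 <= F u)%E ->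
  (\int[P1]_w F (fun i j => Z1 i j w) = \int[P2]_w F (fun i j => Z2 i j w))%E.
Proof.
move=> [mZ1 g1 i1] [mZ2 g2 i2] mF F0.
have mz1 := path_process_measurable mZ1; have mz2 := path_process_measurable mZ2.
have F0' : {in setT, forall u, 0 <= F u}%E by move=> u _; exact: F0.
pose pushf d (T : measurableType d) (P : probability T R) (z : T -> pathT R)
    (mz : measurable_fun setT z) :=
  measure_function_pushforward__canonical__measure_function_Measure P mz.
transitivity (\int[pushf _ _ P1 _ mz1]_u F u)%E.
  by rewrite (ge0_integral_pushforward mz1 P1 measurableT mF F0').
transitivity (\int[pushf _ _ P2 _ mz2]_u F u)%E; last first.
  by rewrite (ge0_integral_pushforward mz2 P2 measurableT mF F0').
apply: eq_measure_integral => A mA _.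
apply: (@measure_unique _ R (pathT R) (@rects R) (fun=> setT) erefl _ _ _
   (pushf _ _ P1 _ mz1) (pushf _ _ P2 _ mz2) _ _ A mA).
- exact: rects_setI.
- move=> i; exists [::], (fun=> setT); split => //.
  by rewrite predeqE => u; split.
- by rewrite bigcup_const//; exists 0%N.
- move=> _ [s [B [us mB ->]]].
  rewrite /pushforward /=.
  transitivity (\prod_(p <- s) normal_prob 0 1 (B p))%E.
    rewrite -[LHS]/(P1 (\bigcap_(p in [set` s]) (Z1 p.1 p.2 @^-1` B p))).
    by rewrite i1//; apply: eq_bigr => p _; rewrite g1.
  rewrite -[RHS]/(P2 (\bigcap_(p in [set` s]) (Z2 p.1 p.2 @^-1` B p))).
  by rewrite i2//; apply: eq_bigr => p _; rewrite g2.
- move=> k; rewrite -[X in (X < _)%E]/(P1 setT).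
  by rewrite probability_setT ltry.
Qed.

End Law.

(** * Rotation invariance *)

Section Gauss2.
Context {R : realType}.
Local Notation mu := (@lebesgue_measure R).
Local Notation gamma := (@normal_prob R 0 1).
Local Notation phi := (@normal_pdf R 0 1).

Lemma measurable_addr (t : R) : measurable_fun setT (fun x : R => x + t).
Proof. by apply: measurable_funD => //; exact: measurable_id. Qed.

Lemma ge0_integral_lebesgue_addr (f : R -> \bar R) (t : R) :
  measurable_fun setT f -> (forall x, 0 <= f x)%E ->
  (\int[mu]_x f ((x : R) + t)%R = \int[mu]_x f x)%E.
Proof.
move=> mf f0.
have f0' : {in setT, forall x, 0 <= f x}%E by move=> x _.
have mt : measurable_fun setT (fun x : measurableTypeR R => x + t : measurableTypeR R).
  exact: measurable_addr.
rewrite -[LHS](ge0_integral_pushforward mt mu measurableT mf f0').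
apply: eq_measure_integral => A mA _; apply/esym.
apply: (@lebesgue_measure_unique R
  (measure_function_pushforward__canonical__measure_function_Measure mu mt)) => //.
move=> _ [[a b]] _ <-.
rewrite -[RHS]/(mu ((fun x => x + t) @^-1` `]a, b]%classic)).
rewrite (_ : _ @^-1` _ = `]a - t, b - t]%classic); last first.
  by apply/seteqP; split => x /=; rewrite !in_itv/= ltrBlDr lerBrDr.
rewrite /= !lebesgue_measure_itv/= !lte_fin ltrD2r.
by case: ifP => // _; rewrite -!EFinD; congr (_%:E); ring.
Qed.

Lemma measurable_phi : measurable_fun setT (fun x : R => (phi x)%:E).
Proof. by apply/measurable_EFinP; exact: measurable_normal_pdf. Qed.

(** The Radon-Nikodym derivative of the normal law and [normal_pdf] have equal integrals over every
    measurable set, hence agree almost everywhere. *)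
Lemma ge0_integral_normal_prob (f : R -> \bar R) :
  measurable_fun setT f -> (forall x, 0 <= f x)%E ->
  (\int[gamma]_x f x = \int[mu]_x (f x * (phi x)%:E))%E.
Proof.
move=> mf f0.
have dom := @normal_prob_dominates R 0 1.
rewrite -(Radon_Nikodym_SigmaFinite.change_of_variables dom)//.
apply: ae_eq_integral => //.
- apply: emeasurable_funM => //.
  by apply: measurable_int; exact: Radon_Nikodym_SigmaFinite.f_integrable.
- by apply: emeasurable_funM => //; exact: measurable_phi.
- apply: ae_eqe_mul2l; apply: integral_ae_eq => //.
  + exact: Radon_Nikodym_SigmaFinite.f_integrable.
  + exact: measurable_phi.
  + by move=> A _ mA; rewrite -Radon_Nikodym_SigmaFinite.f_integral.
Qed.

Lemma normal_prob_prodE (C : set (R * R)) : measurable C ->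
  ((gamma \x gamma) C =
   \int[mu \x mu]_z ((\1_C z)%:E * ((phi z.1)%:E * (phi z.2)%:E)))%E.
Proof.
move=> mC.
have mC' : measurable_fun setT (fun z : R * R => (\1_C z : R)%:E).
  by apply/measurable_EFinP; exact: measurable_indic.
rewrite fubini_tonelli1//=; first last.
- by move=> z; rewrite !mule_ge0// lee_fin normal_pdf_ge0.
- apply: emeasurable_funM => //; apply: emeasurable_funM.
    by apply: (measurableT_comp measurable_phi); exact: measurable_fst.
  by apply: (measurableT_comp measurable_phi); exact: measurable_snd.
rewrite /product_measure1 ge0_integral_normal_prob//=; last first.
  exact: measurable_fun_xsection.
apply: eq_integral => x _.
rewrite /fubini_F /= /normal_prob integral_mkcond/= -ge0_integralZr//; last 3 first.
- apply/(measurable_restrictT _ _).1; first exact: measurable_xsection.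
  by apply/measurable_funTS; exact: measurable_phi.
- by move=> y _; rewrite patchE; case: ifP => // _; rewrite lee_fin normal_pdf_ge0.
- by rewrite lee_fin normal_pdf_ge0.
apply: eq_integral => y _; rewrite patchE mem_xsection indicE.
by case: ifP => _; rewrite ?mul0e// mul1e muleC.
Qed.

Definition shear1 (a : R) (z : R * R) := (z.1 + a * z.2, z.2).
Definition shear2 (a : R) (z : R * R) := (z.1, z.2 + a * z.1).

Lemma measurable_shear1 a : measurable_fun setT (shear1 a).
Proof.
apply: measurable_fun_pair; last exact: measurable_snd.
apply: measurable_funD; first exact: measurable_fst.
by apply: measurable_funM => //; exact: measurable_snd.
Qed.

Lemma measurable_shear2 a : measurable_fun setT (shear2 a).
Proof.
apply: measurable_fun_pair; first exact: measurable_fst.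
apply: measurable_funD; first exact: measurable_snd.
by apply: measurable_funM => //; exact: measurable_fst.
Qed.

Lemma ge0_integral_shear1 (H : R * R -> \bar R) a :
  measurable_fun setT H -> (forall z, 0 <= H z)%E ->
  (\int[mu \x mu]_z H (shear1 a z) = \int[mu \x mu]_z H z)%E.
Proof.
move=> mH H0.
have mHs : measurable_fun setT (H \o shear1 a).
  by apply: measurableT_comp => //; exact: measurable_shear1.
apply: (etrans (fubini_tonelli2 (m1 := mu) (m2 := mu) _ mHs (fun z => H0 _))).
apply: (etrans _ (esym (fubini_tonelli2 (m1 := mu) (m2 := mu) _ mH H0))).
apply: eq_integral => y _; rewrite /fubini_G /=.
apply: (ge0_integral_lebesgue_addr (f := fun x => H (x, y)) (a * y)) => //.
exact: measurableT_comp.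
Qed.

Lemma ge0_integral_shear2 (H : R * R -> \bar R) a :
  measurable_fun setT H -> (forall z, 0 <= H z)%E ->
  (\int[mu \x mu]_z H (shear2 a z) = \int[mu \x mu]_z H z)%E.
Proof.
move=> mH H0.
have mHs : measurable_fun setT (H \o shear2 a).
  by apply: measurableT_comp => //; exact: measurable_shear2.
apply: (etrans (fubini_tonelli1 (m1 := mu) (m2 := mu) _ mHs (fun z => H0 _))).
apply: (etrans _ (esym (fubini_tonelli1 (m1 := mu) (m2 := mu) _ mH H0))).
apply: eq_integral => x _; rewrite /fubini_F /=.
apply: (ge0_integral_lebesgue_addr (f := fun y => H (x, y)) (a * x)) => //.
exact: measurableT_comp.
Qed.

Definition rot2 (c s : R) (z : R * R) := (c * z.1 + s * z.2, c * z.2 - s * z.1).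

(* Shears preserve Lebesgue measure by Tonelli and translation invariance. *)
Lemma rot2_shears c s z : c ^+ 2 + s ^+ 2 = 1 -> s != 0 ->
  rot2 c s z = shear1 ((1 - c) / s) (shear2 (- s) (shear1 ((1 - c) / s) z)).
Proof.
move=> cs s0; case: z => x y; rewrite /rot2 /shear1 /shear2 /=; congr (_, _).
- have e : (1 - c) / s * (1 + c) = s.
    have -> : (1 - c) / s * (1 + c) = (1 - c ^+ 2) / s by field.
    by rewrite -cs addrAC subrr add0r expr2 mulfK.
  by rewrite -{1}e; field.
- by field.
Qed.

Lemma measurable_rot2 c s : measurable_fun setT (rot2 c s).
Proof.
apply: measurable_fun_pair.
  by apply: measurable_funD; apply: measurable_funM.
by apply: measurable_funB; apply: measurable_funM.
Qed.

Lemma normal_pdf2_rot2 c s z : c ^+ 2 + s ^+ 2 = 1 ->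
  phi (rot2 c s z).1 * phi (rot2 c s z).2 = phi z.1 * phi z.2.
Proof.
move=> cs; rewrite normal_pdfE ?oner_eq0// /normal_fun !subr0.
rewrite mulrACA [RHS]mulrACA -!expRD; congr (_ * expR _).
(* Multiplying both squares by c^2 + s^2 = 1 turns equality of the exponents into a polynomial
   identity. *)
have -> : z.1 ^+ 2 = (c ^+ 2 + s ^+ 2) * z.1 ^+ 2 by rewrite cs mul1r.
have -> : z.2 ^+ 2 = (c ^+ 2 + s ^+ 2) * z.2 ^+ 2 by rewrite cs mul1r.
by rewrite /rot2 /=; ring.
Qed.

(** The joint density is constant along rotations, and the three shears composing the rotation
    preserve Lebesgue measure. The shear parameter divides by [s], whence [s != 0]. *)
Lemma normal_prob2_rot2 c s (C : set (R * R)) :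
  c ^+ 2 + s ^+ 2 = 1 -> s != 0 -> measurable C ->
  ((gamma \x gamma) (rot2 c s @^-1` C) = (gamma \x gamma) C)%E.
Proof.
move=> cs s0 mC.
rewrite !normal_prob_prodE//; last first.
  by rewrite -[X in measurable X]setTI; exact: measurable_rot2.
pose H z := ((\1_C z)%:E * ((phi z.1)%:E * (phi z.2)%:E))%E.
have mH : measurable_fun setT H.
  apply: emeasurable_funM; first by apply/measurable_EFinP; exact: measurable_indic.
  apply: emeasurable_funM.
    by apply: (measurableT_comp measurable_phi); exact: measurable_fst.
  by apply: (measurableT_comp measurable_phi); exact: measurable_snd.
have H0 z : (0 <= H z)%E by rewrite !mule_ge0// lee_fin normal_pdf_ge0.
set a := (1 - c) / s.
pose H1 z := H (shear1 a z); pose H2 z := H1 (shear2 (- s) z).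
have mH1 : measurable_fun setT H1.
  exact: (measurableT_comp mH (measurable_shear1 a)).
have mH2 : measurable_fun setT H2.
  exact: (measurableT_comp mH1 (measurable_shear2 (- s))).
transitivity (\int[mu \x mu]_z H2 (shear1 a z))%E; last first.
  rewrite (ge0_integral_shear1 a mH2 (fun z => H0 _)).
  rewrite (ge0_integral_shear2 (- s) mH1 (fun z => H0 _)).
  exact: ge0_integral_shear1.
apply: eq_integral => z _.
have -> : H2 (shear1 a z) = H (rot2 c s z) by rewrite rot2_shears.
rewrite /H -[in RHS]EFinM normal_pdf2_rot2// EFinM; congr (_ * _)%E.
Qed.

End Gauss2.

(** * Gaussian families assembled on product spaces *)

Section IidOn.
Context {R : realType}.

(** Restriction to the indices in [D] lets one factor of a product space supply only part of a
    family. Writing the normal law into the product formula also encodes the marginals, through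
    singleton lists. *)
Definition iid_on {dT} {T : measurableType dT} (D : pred (nat * nat))
  (P : probability T R) (Z : nat -> nat -> T -> R) :=
  (forall i j, D (i, j) -> measurable_fun setT (Z i j)) /\
  (forall (s : seq (nat * nat)) (B : nat * nat -> set R),
     uniq s -> all D s -> (forall p, measurable (B p)) ->
     P (\bigcap_(p in [set` s]) (Z p.1 p.2 @^-1` B p)) =
     (\prod_(p <- s) normal_prob 0 1 (B p))%E).

Lemma iid_onT {dT} {T : measurableType dT} (P : probability T R) Z :
  iid_std_normal P Z <-> iid_on predT P Z.
Proof.
split=> [[mZ g ind]|[mZ ind]].
  split=> [i j _|s B us _ mB]; first exact: mZ.
  by rewrite ind//; apply: eq_bigr => p _; rewrite g.
have g i j A : measurable A -> P (Z i j @^-1` A) = normal_prob 0 1 A.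
  move=> mA; have := ind [:: (i, j)] (fun=> A) isT isT (fun=> mA).
  rewrite big_seq1 => <-; congr (P _); apply/seteqP; split => w /=.
    by move=> wA p; rewrite /= inE => /eqP ->.
  by move=> h; apply: (h (i, j)); rewrite /= inE.
split=> [i j|//|s B us mB]; first exact: mZ.
by rewrite ind ?all_predT//; apply: eq_bigr => p _; rewrite g.
Qed.

Lemma iid_onS {dT} {T : measurableType dT} (D D' : pred (nat * nat))
  (P : probability T R) Z :
  subpred D' D -> iid_on D P Z -> iid_on D' P Z.
Proof.
move=> DD [mZ ind]; split=> [i j /DD|s B us sD mB]; first exact: mZ.
by rewrite ind//; apply: sub_all sD.
Qed.

(* Independence and invariance arguments are run by rebuilding the family on a
   product space, part of it read off each factor, and comparing laws. *)
Definition splice {T1 T2 : Type} (a : pred (nat * nat)) (Z1 : nat -> nat -> T1 -> R)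
  (Z2 : nat -> nat -> T2 -> R) (i j : nat) (w : T1 * T2) : R :=
  if a (i, j) then Z1 i j w.1 else Z2 i j w.2.

Lemma iid_splice {d1 d2} {T1 : measurableType d1} {T2 : measurableType d2}
  (P1 : probability T1 R) (P2 : probability T2 R) (a : pred (nat * nat)) Z1 Z2 :
  iid_on a P1 Z1 -> iid_on (predC a) P2 Z2 ->
  iid_std_normal (P1 \x P2)%E (splice a Z1 Z2).
Proof.
move=> [mZ1 i1] [mZ2 i2]; apply/iid_onT; split=> [i j _|s B us _ mB].
  rewrite /splice; have [aij|aij] := boolP (a (i, j)).
    by apply: (measurableT_comp (f := Z1 i j)) => //; exact: mZ1.
  by apply: (measurableT_comp (f := Z2 i j)) => //; exact: mZ2.
pose s1 := seq.filter a s; pose s2 := seq.filter (predC a) s.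
rewrite (_ : \bigcap_(p in _) _ =
   (\bigcap_(p in [set` s1]) (Z1 p.1 p.2 @^-1` B p)) `*`
   (\bigcap_(p in [set` s2]) (Z2 p.1 p.2 @^-1` B p))); last first.
  apply/seteqP; split => -[w1 w2] /=.
    move=> h; split=> p /=; rewrite mem_filter => /andP[/= ap ps];
    have := h p ps; rewrite /splice/= -surjective_pairing.
      by rewrite ap.
    by rewrite (negbTE ap).
  move=> [h1 h2] p /= ps; rewrite /splice -surjective_pairing.
  by case: ifPn => ap; [apply: h1|apply: h2]; rewrite /= mem_filter /= ap.
rewrite [LHS]product_measure1E; last 2 first.
- rewrite bigcap_seq big_seq; apply: big_ind => //; first exact: measurableI.
  move=> p; rewrite mem_filter => /andP[ap _].
  by rewrite -[X in measurable X]setTI; apply: mZ1 => //; rewrite -surjective_pairing.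
- rewrite bigcap_seq big_seq; apply: big_ind => //; first exact: measurableI.
  move=> p; rewrite mem_filter => /andP[ap _].
  by rewrite -[X in measurable X]setTI; apply: mZ2 => //; rewrite /= -surjective_pairing.
transitivity (\prod_(p <- s1) normal_prob 0 1 (B p) *
              \prod_(p <- s2) normal_prob 0 1 (B p))%E.
  by congr (_ * _)%E; [apply: i1|apply: i2]; rewrite ?filter_uniq ?filter_all.
by rewrite !big_filter [RHS](bigID a).
Qed.

(** With [X] the identity or a rotation of the plane, this gives the original or the rotated version
    of two entries. *)
Definition pairZ (q1 q2 : nat * nat) (X : R * R -> R * R) (i j : nat) (z : R * R) : R :=
  if (i, j) == q1 then (X z).1 else (X z).2.

Lemma iid_on_pair (q1 q2 : nat * nat)
  (mu : probability (measurableTypeR R * measurableTypeR R)%type R)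
  (X : R * R -> R * R) :
  q1 != q2 -> measurable_fun setT X ->
  (forall A B, measurable A -> measurable B ->
    mu (X @^-1` (A `*` B)) = (normal_prob 0 1 A * normal_prob 0 1 B)%E) ->
  iid_on (mem [:: q1; q2]) mu (pairZ q1 q2 X).
Proof.
move=> q12 mX gX; split=> [i j _|s B us sq mB].
  rewrite /pairZ; case: ((i, j) == q1).
    by apply: (measurableT_comp (f := fst)).
  by apply: (measurableT_comp (f := snd)).
(* An index missing from [s] gets [setT], of mass 1, so the event is always the preimage of a
   product of two sets. *)
pose A q := if q \in s then B q else setT.
have mA q : measurable (A q) by rewrite /A; case: ifP.
rewrite (_ : \bigcap_(p in _) _ = X @^-1` (A q1 `*` A q2)); last first.
  apply/seteqP; split => z /=.
    move=> h; split; rewrite /A; case: ifP => // qs; have := h _ qs;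
      rewrite /pairZ -surjective_pairing ?eqxx//.
    by rewrite eq_sym (negbTE q12).
  rewrite /A => -[h1 h2] p /= ps; rewrite /pairZ -surjective_pairing.
  have := allP sq p ps; rewrite /= !inE => /orP[] /eqP e; move: ps; rewrite e => ps.
    by move: h1; rewrite ps eqxx.
  by move: h2; rewrite ps eq_sym (negbTE q12).
have ps : perm_eq s (seq.filter (mem s) [:: q1; q2]).
  apply: uniq_perm => //; first by rewrite filter_uniq//= inE q12.
  move=> p; rewrite mem_filter; case: (boolP (p \in s)) => /= [pins|/negbTE ->//].
  by rewrite pins; have := allP sq p pins.
rewrite gX// (perm_big _ ps) big_filter !big_cons big_nil /A /= mule1.
by do 2 (case: ifP => _); rewrite ?probability_setT ?mul1e ?mule1.
Qed.

End IidOn.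

(** * SGD steps and products as functions of a path of standard normals *)

Section Steps.
Context {R : realType}.

Definition gvec (d : nat) (u : nat -> nat -> R) (i : nat) : 'cV[R]_d := \col_j u i j.

Definition smx (c : R) (d b : nat) (u : nat -> nat -> R) : 'M[R]_d :=
  1%:M - c *: \sum_(i < b) gvec d u i *m (gvec d u i)^T.

Definition shift_path (n : nat) (u : nat -> nat -> R) : nat -> nat -> R :=
  fun i j => u (n + i)%N j.

Fixpoint pmx (c : R) (d b k : nat) (u : nat -> nat -> R) : 'M[R]_d :=
  if k is k'.+1 then smx c d b (shift_path (b * k') u) *m pmx c d b k' u else 1%:M.

Lemma Mmat_smx {dT} {T : measurableType dT} (Z : nat -> nat -> T -> R) eta var b d k w :
  0 <= var ->
  Mmat Z eta var b d k.+1 w =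
  smx (eta / b%:R * var) d b (shift_path (b * k) (fun i j => Z i j w)).
Proof.
move=> v0; rewrite /Mmat /smx -[(_ * var) *: _]scalerA; congr (_ - _ *: _).
rewrite /Hmat subn1 /= -{1}[(b * k)%N]add0n big_addn mulnS addnK big_mkord.
rewrite scaler_sumr; apply: eq_bigr => i _.
have -> : avec Z var d (i + b * k) w =
    Num.sqrt var *: gvec d (shift_path (b * k) (fun i j => Z i j w)) i.
  by apply/matrixP => j l; rewrite !mxE addnC.
by rewrite linearZ /= -scalemxAl -scalemxAr scalerA -expr2 sqr_sqrtr.
Qed.

Lemma Pimat_pmx {dT} {T : measurableType dT} (Z : nat -> nat -> T -> R) eta var b d k w :
  0 <= var ->
  Pimat Z eta var b d k w = pmx (eta / b%:R * var) d b k (fun i j => Z i j w).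
Proof. by move=> v0; elim: k => //= k ->; rewrite Mmat_smx. Qed.

Lemma eq_smx c d b u u' : (forall i j, (i < b)%N -> u i j = u' i j) ->
  smx c d b u = smx c d b u'.
Proof.
move=> uu'; rewrite /smx; congr (_ - _ *: _); apply: eq_bigr => i _.
by have -> : gvec d u i = gvec d u' i by apply/matrixP => j l; rewrite !mxE uu'.
Qed.

(** Locality in the samples: it lets the past and the next batch be placed on different factors of a
    product space. *)
Lemma eq_pmx c d b k u u' : (forall i j, (i < b * k)%N -> u i j = u' i j) ->
  pmx c d b k u = pmx c d b k u'.
Proof.
elim: k => //= k IH uu'; congr (_ *m _).
  by apply: eq_smx => i j ib; rewrite /shift_path uu'// mulnS addnC ltn_add2r.
by apply: IH => i j ib; rewrite uu'// mulnS ltn_addl.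
Qed.

Definition measurable_mx {d'} {T : measurableType d'} m n (A : T -> 'M[R]_(m, n)) :=
  forall i j, measurable_fun setT (fun w => A w i j).

Section MeasurableMx.
Context {d' : measure_display} {T : measurableType d'}.

Lemma measurable_mx_cst m n (A : 'M[R]_(m, n)) : measurable_mx (fun _ : T => A).
Proof. by move=> i j; exact: measurable_cst. Qed.

Lemma measurable_mxM m n p (A : T -> 'M[R]_(m, n)) (B : T -> 'M[R]_(n, p)) :
  measurable_mx A -> measurable_mx B -> measurable_mx (fun w => A w *m B w).
Proof.
move=> mA mB i j; under eq_fun do rewrite mxE.
by apply: measurable_sum => k; apply: measurable_funM.
Qed.

Lemma measurable_smx c d b (u : T -> nat -> nat -> R) :
  (forall i j, measurable_fun setT (fun w => u w i j)) ->
  measurable_mx (fun w => smx c d b (u w)).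
Proof.
move=> mu i j; rewrite /smx.
under eq_fun do rewrite !mxE summxE.
apply: measurable_funB => //; apply: measurable_funM => //.
apply: measurable_sum => k; under eq_fun do rewrite !mxE.
apply: measurable_sum => l; under eq_fun do rewrite !mxE.
by apply: measurable_funM.
Qed.

Lemma measurable_pmx c d b k (u : T -> nat -> nat -> R) :
  (forall i j, measurable_fun setT (fun w => u w i j)) ->
  measurable_mx (fun w => pmx c d b k (u w)).
Proof.
move=> mu; elim: k => [|k IH] /=; first exact: measurable_mx_cst.
by apply: measurable_mxM => //; apply: measurable_smx => i j; exact: mu.
Qed.

Lemma measurable_vnorm_powR d (v : T -> 'cV[R]_d) s :
  measurable_mx v -> measurable_fun setT (fun w => ((vnorm (v w)) `^ s)%:E).
Proof.
move=> mv; apply/measurable_EFinP.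
have mS : measurable_fun setT (fun w => \sum_(j < d) (v w j 0) ^+ 2).
  by apply: measurable_sum => j; apply: measurable_funX; exact: mv.
have mq : measurable_fun setT (@Num.sqrt R).
  by apply: continuous_measurable_fun; exact: sqrt_continuous.
exact: (measurableT_comp (measurable_powR s) (measurableT_comp mq mS)).
Qed.

End MeasurableMx.

Lemma vnormE d (v : 'cV[R]_d) : vnorm v = Num.sqrt ((v^T *m v) 0 0).
Proof.
by rewrite mxE; congr Num.sqrt; apply: eq_bigr => j _; rewrite mxE expr2.
Qed.

Lemma vnorm_ge0 d (v : 'cV[R]_d) : 0 <= vnorm v.
Proof. exact: sqrtr_ge0. Qed.

Lemma vnorm_orth d (Q : 'M[R]_d) (v : 'cV[R]_d) : Q^T *m Q = 1%:M ->
  vnorm (Q *m v) = vnorm v.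
Proof. by move=> QQ; rewrite !vnormE trmx_mul -mulmxA (mulmxA Q^T) QQ mul1mx. Qed.

Lemma vnormZ d (v : 'cV[R]_d) a : vnorm (a *: v) = `|a| * vnorm v.
Proof.
rewrite /vnorm -sqrtr_sqr -sqrtrM ?sqr_ge0// mulr_sumr; congr Num.sqrt.
by apply: eq_bigr => j _; rewrite mxE exprMn.
Qed.

Definition givens d (n : 'I_d.+1) (c s : R) : 'M[R]_d.+1 :=
  1%:M + (c - 1) *: (delta_mx 0 0 + delta_mx n n) + s *: (delta_mx 0 n - delta_mx n 0).

Lemma tr_givens d (n : 'I_d.+1) c s : (givens n c s)^T = givens n c (- s).
Proof.
by apply/matrixP => i j; rewrite !mxE (eq_sym j i) !(andbC (j == _)); ring.
Qed.

(** The matrix is I + (c - 1) A + s J, with A the projection onto the plane of coordinates 0 and [n]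
    and J a quarter turn in it. The relations A A = A, A J = J A = J, J J = - A reduce orthogonality
    to c^2 + s^2 = 1. *)
Lemma givens_orth d (n : 'I_d.+1) c s : n != 0 -> c ^+ 2 + s ^+ 2 = 1 ->
  (givens n c s)^T *m givens n c s = 1%:M.
Proof.
move=> n0 cs; rewrite tr_givens /givens.
set A := delta_mx 0 0 + delta_mx n n; set J := delta_mx 0 n - delta_mx n 0.
have AA : A *m A = A.
  rewrite /A mulmxDl !mulmxDr !mul_delta_mx_cond !eqxx (negbTE n0) eq_sym (negbTE n0).
  by rewrite !mulr1n !mulr0n addr0 add0r.
have AJ : A *m J = J.
  rewrite /A /J mulmxDl !mulmxBr !mul_delta_mx_cond !eqxx (negbTE n0) eq_sym (negbTE n0).
  by rewrite !mulr1n !mulr0n subr0 sub0r.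
have JA : J *m A = J.
  rewrite /A /J mulmxBl !mulmxDr !mul_delta_mx_cond !eqxx (negbTE n0) eq_sym (negbTE n0).
  by rewrite !mulr1n !mulr0n addr0 add0r.
have JJ : J *m J = - A.
  rewrite /A /J mulmxBl !mulmxBr !mul_delta_mx_cond !eqxx (negbTE n0) eq_sym (negbTE n0).
  by rewrite !mulr1n !mulr0n subr0 sub0r opprD.
rewrite !mulmxDl !mulmxDr !mul1mx !mulmx1 -!scalemxAl -!scalemxAr AA AJ JA JJ.
rewrite !scalerA.
apply/matrixP => i j; rewrite !mxE.
have s2 : s ^+ 2 = 1 - c ^+ 2 by rewrite -cs; ring.
ring: s2.
Qed.

Lemma givens_mul d (n : 'I_d.+1) c s (v : 'cV[R]_d.+1) : n != 0 ->
  givens n c s *m v = \col_j (if j == 0 then c * v 0 0 + s * v n 0 else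
     if j == n then c * v n 0 - s * v 0 0 else v j 0).
Proof.
move=> n0; rewrite /givens !mulmxDl mul1mx -!scalemxAl mulmxDl mulmxBl.
have E (i j : 'I_d.+1) : delta_mx i j *m v = v j 0 *: delta_mx i 0.
  apply/matrixP => k l; rewrite !mxE (bigD1 j)//= big1 => [|m mj].
    by rewrite !mxE eqxx !ord1 addr0 mulrC andbT.
  by rewrite mxE (negbTE mj) andbF mul0r.
rewrite !E; apply/matrixP => j l; rewrite !mxE !ord1 eqxx !andbT.
have [->|j0] := eqVneq j 0.
  by rewrite eq_sym (negbTE n0) /=; ring.
have [->|jn] := eqVneq j n; by rewrite /=; ring.
Qed.

End Steps.

(** * Symmetries of the law of the samples *)

Section Isotropy.
Context {R : realType} {dT : measure_display} {T : measurableType dT}.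
Variables (P : probability T R) (Z : nat -> nat -> T -> R).
Hypothesis iidZ : iid_std_normal P Z.

Local Notation path w := (fun i j => Z i j w).

Lemma measurable_iid i j : measurable_fun setT (Z i j).
Proof. by case: iidZ. Qed.

Definition rot_row (n : nat) (c s : R) (i0 : nat) (u : nat -> nat -> R) : nat -> nat -> R :=
  fun i j => if (i, j) == (i0, 0%N) then c * u i0 0%N + s * u i0 n
    else if (i, j) == (i0, n) then c * u i0 n - s * u i0 0%N else u i j.

Definition rot_rows (n : nat) (c s : R) (b : nat) (u : nat -> nat -> R) : nat -> nat -> R :=
  fun i j => if (i < b)%N then rot_row n c s i u i j else u i j.

Lemma measurable_rot_row {d'} {S : measurableType d'} (u : S -> nat -> nat -> R) n c s i0 :
  (forall i j, measurable_fun setT (fun w => u w i j)) ->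
  forall i j, measurable_fun setT (fun w => rot_row n c s i0 (u w) i j).
Proof.
move=> mu i j; rewrite /rot_row.
case: eqP => _; first by apply: measurable_funD; apply: measurable_funM.
by case: eqP => _; first by apply: measurable_funB; apply: measurable_funM.
Qed.

Lemma measurable_rot_row_path n c s i0 :
  measurable_fun setT (rot_row n c s i0 : pathT R -> pathT R).
Proof.
apply: (path_process_measurable (Z := fun i j (u : pathT R) => rot_row n c s i0 u i j)).
by apply: (measurable_rot_row (u := fun u : pathT R => u)) => i j; exact: measurable_coord.
Qed.

(** Entries 0 and [n] of sample [i0] are replaced by a fresh Gaussian pair, once as it stands and
    once rotated. Both spliced families are i.i.d., and rotating the first gives the second
    pointwise. *)
Lemma law_rot_row n c s i0 (F : pathT R -> \bar R) :
  n != 0%N -> c ^+ 2 + s ^+ 2 = 1 -> s != 0 ->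
  measurable_fun setT F -> (forall u, 0 <= F u)%E ->
  (\int[P]_w F (path w) = \int[P]_w F (rot_row n c s i0 (path w)))%E.
Proof.
move=> n0 cs s0 mF F0.
pose q1 := (i0, 0%N); pose q2 := (i0, n).
have q12 : q1 != q2 by rewrite xpair_eqE eqxx /= eq_sym.
pose mu2 : probability (measurableTypeR R * measurableTypeR R)%type R :=
  (normal_prob 0 1 \x normal_prob 0 1)%E.
pose a : pred (nat * nat) := predC (mem [:: q1; q2]).
pose W X := splice a Z (pairZ q1 q2 X).
have iW X : measurable_fun setT X ->
    (forall A B, measurable A -> measurable B ->
      mu2 (X @^-1` (A `*` B)) = (normal_prob 0 1 A * normal_prob 0 1 B)%E) ->
    iid_std_normal (P \x mu2)%E (W X).
  move=> mX gX; apply: iid_splice.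
    by apply: (iid_onS (D := predT)) => //; exact/iid_onT.
  apply: (iid_onS (D := mem [:: q1; q2])); first by move=> p; rewrite /a /= negbK.
  exact: iid_on_pair.
have i1 : iid_std_normal (P \x mu2)%E (W id).
  by apply: iW => // A B mA mB; exact: product_measure1E.
have i2 : iid_std_normal (P \x mu2)%E (W (rot2 c s)).
  apply: iW; first exact: measurable_rot2.
  move=> A B mA mB; rewrite [LHS]normal_prob2_rot2//; last exact: measurableX.
  exact: product_measure1E.
rewrite [LHS](iid_law_unique iidZ i2 mF F0).
have mF' : measurable_fun setT (F \o (rot_row n c s i0 : pathT R -> pathT R)).
  by apply: measurableT_comp => //; exact: measurable_rot_row_path.
rewrite [RHS](iid_law_unique iidZ i1 mF' (fun u => F0 _)).
apply: eq_integral => -[w [x y]] _ /=; congr (F _).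
apply/funext => i; apply/funext => j.
rewrite /rot_row /W /splice /pairZ /a /= !inE -/q1 -/q2 !eqxx /= (eq_sym q2) (negbTE q12) /=.
by case: ((i, j) == q1); case: ((i, j) == q2).
Qed.

Lemma law_rot_rows n c s b (F : pathT R -> \bar R) :
  n != 0%N -> c ^+ 2 + s ^+ 2 = 1 -> s != 0 ->
  measurable_fun setT F -> (forall u, 0 <= F u)%E ->
  (\int[P]_w F (path w) = \int[P]_w F (rot_rows n c s b (path w)))%E.
Proof.
move=> n0 cs s0; elim: b F => [|b IH] F mF F0; first by apply: eq_integral.
rewrite (law_rot_row b n0 cs s0 mF F0).
have mF' : measurable_fun setT (F \o (rot_row n c s b : pathT R -> pathT R)).
  by apply: measurableT_comp => //; exact: measurable_rot_row_path.
rewrite [LHS](IH _ mF' (fun u => F0 _)).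
apply: eq_integral => w _ /=; congr (F _).
apply/funext => i; apply/funext => j; rewrite /rot_rows.
rewrite /rot_row ltnn ltnS !xpair_eqE.
have [->|ib] := eqVneq i b; first by rewrite leqnn ltnn eqxx.
by rewrite ltn_neqAle ib.
Qed.

(** Relabelling samples injectively preserves the law. It serves twice: for the shift to the next
    batch and for the leave-one-out batches. *)
Lemma law_rows (f : nat -> nat) (F : pathT R -> \bar R) :
  injective f -> measurable_fun setT F -> (forall u, 0 <= F u)%E ->
  (\int[P]_w F (fun i j => Z (f i) j w) = \int[P]_w F (path w))%E.
Proof.
move=> finj mF F0.
suff iidf : iid_std_normal P (fun i j => Z (f i) j) by exact: (iid_law_unique iidf iidZ).
have [mZ g ind] := iidZ; split=> [i j|i j A mA|s B us mB]; [exact: mZ|exact: g|].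
pose h (p : nat * nat) := (f p.1, p.2).
have hinj : injective h by move=> [i j] [k l] [/finj -> ->].
(* Constraints are transported along [h]; at an index not hit from [s] the intersection is empty, so
   it is [setT]. *)
pose B' (q : nat * nat) : set R :=
  \bigcap_(p in [set p | p \in s /\ h p = q]) B p.
have B'h p : p \in s -> B' (h p) = B p.
  move=> ps; apply/seteqP; split => x; first by apply.
  by move=> Bx q [_ /hinj ->].
have mB' q : measurable (B' q).
  have [[p [ps <-]]|nex] := pselect (exists p, p \in s /\ h p = q).
    by rewrite B'h.
  rewrite (_ : B' q = setT)//; apply/seteqP; split => // x _ p [ps hp].
  by exfalso; apply: nex; exists p.
have := ind (map h s) B'; rewrite map_inj_uniq// => /(_ us mB').
rewrite big_map => e.
rewrite (_ : \bigcap_(p in _) _ =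
  \bigcap_(p in [set` map h s]) (Z p.1 p.2 @^-1` B' p)); last first.
  apply/seteqP; split => w hw p /=.
    by move=> /mapP[q qs ->]; rewrite B'h//; exact: hw.
  by move=> ps; have := hw (h p) (map_f h ps); rewrite /= B'h.
by rewrite e big_seq [RHS]big_seq; apply: eq_bigr => p ps; rewrite B'h.
Qed.

End Isotropy.

(** * Isotropy of one step and factorisation of the moments of products *)

Section StepMoment.
Context {R : realType} {dT : measure_display} {T : measurableType dT}.
Variables (P : probability T R) (Z : nat -> nat -> T -> R).
Hypothesis iidZ : iid_std_normal P Z.

Local Notation path w := (fun i j => Z i j w).

Lemma gvec_rot_rows d (n : 'I_d.+1) (c s : R) b u i : n != 0 -> (i < b)%N ->
  gvec d.+1 (rot_rows n c s b u) i = givens n c s *m gvec d.+1 u i.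
Proof.
move=> n0 ib; rewrite givens_mul//; apply/matrixP => j l.
by rewrite !mxE /rot_rows ib /rot_row !xpair_eqE eqxx.
Qed.

Lemma smx_rot_rows d (n : 'I_d.+1) (a c s : R) b u : n != 0 -> c ^+ 2 + s ^+ 2 = 1 ->
  smx a d.+1 b (rot_rows n c s b u) =
  givens n c s *m smx a d.+1 b u *m (givens n c s)^T.
Proof.
move=> n0 cs; have GG := mulmx1C (givens_orth n0 cs).
rewrite /smx mulmxBr mulmx1 mulmxBl GG -scalemxAr -scalemxAl; congr (_ - _ *: _).
rewrite mulmx_sumr mulmx_suml; apply: eq_bigr => i _.
by rewrite gvec_rot_rows// trmx_mul !mulmxA.
Qed.

Lemma measurable_smx_path {d'} {S : measurableType d'} (Y : nat -> nat -> S -> R) c d b s v :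
  (forall i j, measurable_fun setT (Y i j)) ->
  measurable_fun setT (fun w => (vnorm (smx c d b (fun i j => Y i j w) *m v) `^ s)%:E).
Proof.
move=> mY; apply: measurable_vnorm_powR; apply: measurable_mxM.
  exact: (@measurable_smx R _ _ c d b (fun w i j => Y i j w)).
exact: measurable_mx_cst.
Qed.

Lemma powR_EFin_ge0 (x s : R) : (0 <= (x `^ s)%:E)%E.
Proof. by rewrite lee_fin powR_ge0. Qed.

(** Rotating all samples conjugates the step matrix by the rotation G, and the outer G drops out of
    the norm; what remains is Gᵀ acting on [v]. *)
Lemma integral_smx_givens d (n : 'I_d.+1) (a c s t : R) b (v : 'cV[R]_d.+1) :
  n != 0 -> c ^+ 2 + s ^+ 2 = 1 -> s != 0 ->
  (\int[P]_w (vnorm (smx a d.+1 b (path w) *m v) `^ t)%:E =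
   \int[P]_w (vnorm (smx a d.+1 b (path w) *m ((givens n c s)^T *m v)) `^ t)%:E)%E.
Proof.
move=> n0 cs s0.
have n0' : nat_of_ord n != 0%N by [].
have mF := measurable_smx_path (S := pathT R) (Y := fun i j (u : pathT R) => u i j) a b t v
  measurable_coord.
apply: (etrans (law_rot_rows iidZ b n0' cs s0 mF (fun u => powR_EFin_ge0 _ _))).
have E u : vnorm (smx a d.+1 b (rot_rows n c s b u) *m v) =
    vnorm (smx a d.+1 b u *m ((givens n c s)^T *m v)).
  by rewrite smx_rot_rows// -!mulmxA vnorm_orth//; exact: givens_orth.
by apply: eq_integral => w _; congr ((_ `^ t)%:E); exact: E.
Qed.

(** This is m of the overview in dimension [d.+1], so that e_0 exists. The value is an extended
    real, +oo being possible. *)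
Definition moment (c : R) (d b : nat) (s : R) : \bar R :=
  (\int[P]_w (vnorm (smx c d.+1 b (path w) *m delta_mx 0 0) `^ s)%:E)%E.

(** Induction on a bound [n] for the last nonzero coordinate: a rotation moves coordinate [n.+1]
    into coordinate 0, and at [n = 0] the vector is a multiple of e_0. *)
Lemma integral_smx_isotropic c d b s (v : 'cV[R]_d.+1) :
  (\int[P]_w (vnorm (smx c d.+1 b (path w) *m v) `^ s)%:E =
   (vnorm v `^ s)%:E * moment c d b s)%E.
Proof.
suff H n : forall v : 'cV[R]_d.+1, (forall j : 'I_d.+1, (n < j)%N -> v j 0 = 0) ->
  (\int[P]_w (vnorm (smx c d.+1 b (path w) *m v) `^ s)%:E =
   (vnorm v `^ s)%:E * moment c d b s)%E.
  by apply: (H d) => j dj; have := ltn_ord j; rewrite ltnS leqNgt dj.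
elim: n => [|n IH] {}v v0.
  have -> : v = v 0 0 *: delta_mx 0 0.
    apply/matrixP => j l; rewrite !mxE !ord1 andbT.
    have [->|j0] := eqVneq j 0; first by rewrite mulr1.
    by rewrite mulr0 v0// lt0n.
  set a := v 0 0.
  have ve : vnorm (delta_mx 0 0 : 'cV[R]_d.+1) = 1.
    rewrite /vnorm (bigD1 0)//= big1 => [|j j0]; first by rewrite !mxE eqxx expr1n addr0 sqrtr1.
    by rewrite mxE (negbTE j0) expr0n.
  rewrite vnormZ ve mulr1 /moment -ge0_integralZl ?powR_EFin_ge0//; first last.
  - by move=> w _; exact: powR_EFin_ge0.
  - by apply: measurable_smx_path; exact: measurable_iid iidZ.
  by apply: eq_integral => w _; rewrite -scalemxAr vnormZ powRM// ?vnorm_ge0// EFinM.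
have [nd|nd] := ltnP n.+1 d.+1; last first.
  by apply: IH => j nj; apply: v0; apply: (leq_ltn_trans _ nj); have := ltn_ord j; lia.
pose m : 'I_d.+1 := Ordinal nd.
have m0 : m != 0 by [].
(* A vanishing coordinate is split off because the rotation below would have zero sine, which the
   shear decomposition excludes. *)
have [vm|vm] := eqVneq (v m 0) 0.
  apply: IH => j nj; have [jn|jn] := ltnP n.+1 j; first exact: v0.
  by have -> : j = m by apply: val_inj => /=; lia.
pose r := Num.sqrt (v 0 0 ^+ 2 + v m 0 ^+ 2).
have r2 : r ^+ 2 = v 0 0 ^+ 2 + v m 0 ^+ 2 by rewrite sqr_sqrtr// addr_ge0 ?sqr_ge0.
have r0 : r != 0.
  rewrite sqrtr_eq0 -ltNge.
  by apply: ltr_wpDl; rewrite ?sqr_ge0// lt0r sqr_ge0 sqrf_eq0 vm.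
(* The angle makes coordinate [m] of Gᵀ v vanish; the minus sign in [sn] accounts for the
   transpose. *)
pose cs := v 0 0 / r; pose sn := - v m 0 / r.
have e : cs ^+ 2 + sn ^+ 2 = 1.
  by rewrite /cs /sn !expr_div_n sqrrN -mulrDl -r2 divff// sqrf_eq0.
have sn0 : sn != 0 by rewrite mulf_neq0// ?oppr_eq0// invr_eq0.
rewrite (integral_smx_givens c s b v m0 e sn0).
have orth : (givens m cs sn)^T^T *m (givens m cs sn)^T = 1%:M.
  by rewrite trmxK; exact: mulmx1C (givens_orth m0 e).
rewrite -[in RHS](vnorm_orth v orth); apply: IH => j nj.
rewrite tr_givens givens_mul// mxE.
have [j0|j0] := eqVneq j 0; first by move: nj; rewrite j0.
case: eqVneq => jm; last first.
  have [jn|jn] := ltnP n.+1 j; first exact: v0.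
  by case/eqP: jm; apply: val_inj => /=; lia.
by rewrite /cs /sn; ring.
Qed.

(** The newest batch is read off an independent second copy of the sample space. Tonelli then plays
    the role of conditioning: with the past fixed, the inner integral is an isotropic one-step
    moment. *)
Lemma integral_pmx c d b k s (v : 'cV[R]_d.+1) :
  (\int[P]_w (vnorm (pmx c d.+1 b k (path w) *m v) `^ s)%:E =
   (vnorm v `^ s)%:E * moment c d b s ^+ k)%E.
Proof.
have mZ := measurable_iid iidZ.
elim: k => [|k IH].
  rewrite expe0 mule1 /=; under eq_integral do rewrite mul1mx.
  by rewrite integral_cst//= probability_setT mule1.
pose a : pred (nat * nat) := fun p => (p.1 < b * k)%N.
pose W := splice a Z Z.
have iW : iid_std_normal (P \x P)%E W.
  by apply: iid_splice; apply: (iid_onS (D := predT)) => //; exact/iid_onT.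
pose F (u : pathT R) := (vnorm (pmx c d.+1 b k.+1 u *m v) `^ s)%:E.
have mF : measurable_fun setT F.
  apply: measurable_vnorm_powR; apply: measurable_mxM; last exact: measurable_mx_cst.
  exact: (@measurable_pmx R _ (pathT R) c d.+1 b k.+1 (fun u => u) measurable_coord).
have F0 u : (0 <= F u)%E by exact: powR_EFin_ge0.
rewrite (iid_law_unique iidZ iW mF F0).
have E w : pmx c d.+1 b k.+1 (fun i j => W i j w) =
    smx c d.+1 b (fun i j => Z (b * k + i)%N j w.2) *m pmx c d.+1 b k (path w.1).
  have -> : pmx c d.+1 b k (path w.1) = pmx c d.+1 b k (fun i j => W i j w).
    by apply: eq_pmx => i j ib; rewrite /W /splice /a /= ib.
  rewrite (_ : smx _ _ _ _ = smx c d.+1 b (shift_path (b * k) (fun i j => W i j w)))//.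
  apply: eq_smx => i j ib; rewrite /shift_path /W /splice /a /=.
  by rewrite ltnNge leq_addr.
have FE w : F (fun i j => W i j w) =
    (vnorm (smx c d.+1 b (fun i j => Z (b * k + i)%N j w.2) *m
       (pmx c d.+1 b k (path w.1) *m v)) `^ s)%:E.
  by rewrite mulmxA -E.
have mW : measurable_fun setT (fun w => F (fun i j => W i j w)).
  apply: (measurableT_comp mF); apply: path_process_measurable.
  by case: iW.
apply: (etrans (fubini_tonelli1 (m1 := P) (m2 := P) _ mW (fun w => F0 _))).
rewrite expeS muleCA -IH -ge0_integralZl//; last 3 first.
- apply: measurable_vnorm_powR; apply: measurable_mxM; last exact: measurable_mx_cst.
  exact: (@measurable_pmx R _ _ c d.+1 b k (fun w i j => Z i j w)).
- by move=> w _; exact: powR_EFin_ge0.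
- by apply: integral_ge0 => w _; exact: powR_EFin_ge0.
apply: eq_integral => w _; rewrite /fubini_F.
under eq_integral do rewrite FE /=.
set x := _ *m v.
have mG := measurable_smx_path (S := pathT R) (Y := fun i j (u : pathT R) => u i j) c b s x
  measurable_coord.
rewrite (law_rows iidZ (@addnI (b * k)%N) mG (fun u => powR_EFin_ge0 _ _)).
by rewrite integral_smx_isotropic muleC.
Qed.

End StepMoment.

(** * Norm and power inequalities *)

Section EuclideanNorm.
Context {R : realType}.

Lemma sqr_vnorm d (v : 'cV[R]_d) : vnorm v ^+ 2 = \sum_j v j 0 ^+ 2.
Proof. by rewrite sqr_sqrtr// sumr_ge0// => j _; rewrite sqr_ge0. Qed.

Lemma vnorm0 d : vnorm (0 : 'cV[R]_d) = 0.
Proof. by rewrite /vnorm big1 ?sqrtr0// => j _; rewrite mxE expr0n. Qed.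

Lemma vnorm0_eq0 d (v : 'cV[R]_d) : vnorm v = 0 -> v = 0.
Proof.
move=> v0; have := sqr_vnorm v; rewrite v0 expr0n => /esym/eqP.
rewrite psumr_eq0 => [/allP h|j _]; last exact: sqr_ge0.
apply/matrixP => i j; rewrite ord1 mxE.
by have := h i (mem_index_enum _); rewrite /= sqrf_eq0 => /eqP.
Qed.

Lemma coord_le_vnorm d (v : 'cV[R]_d) j : `|v j 0| <= vnorm v.
Proof.
rewrite -sqrtr_sqr ler_wsqrtr// (bigD1 j)//= lerDl sumr_ge0// => i _.
exact: sqr_ge0.
Qed.

(** With X, Y the norms and S the inner product, the sum of the squares (Y x_j - X y_j)^2 equals 2 X
    Y (X Y - S). *)
Lemma vnorm_CauchySchwarz d (x y : 'cV[R]_d) :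
  \sum_j x j 0 * y j 0 <= vnorm x * vnorm y.
Proof.
have [x0|x0] := eqVneq (vnorm x) 0.
  by rewrite x0 mul0r (vnorm0_eq0 x0) big1// => j _; rewrite mxE mul0r.
have [y0|y0] := eqVneq (vnorm y) 0.
  by rewrite y0 mulr0 (vnorm0_eq0 y0) big1// => j _; rewrite mxE mulr0.
set X := vnorm x; set Y := vnorm y; set S := \sum_j _.
have XY : 0 < X * Y by rewrite mulr_gt0// lt0r ?x0 ?y0 vnorm_ge0.
have : 0 <= \sum_j (Y * x j 0 - X * y j 0) ^+ 2 by rewrite sumr_ge0// => j _; rewrite sqr_ge0.
have -> : \sum_j (Y * x j 0 - X * y j 0) ^+ 2 =
    Y ^+ 2 * \sum_j x j 0 ^+ 2 - (X * Y *+ 2) * S + X ^+ 2 * \sum_j y j 0 ^+ 2.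
  rewrite !mulr_sumr -sumrB -big_split /=; apply: eq_bigr => j _; ring.
rewrite -!sqr_vnorm -/X -/Y.
have -> : Y ^+ 2 * X ^+ 2 - X * Y *+ 2 * S + X ^+ 2 * Y ^+ 2 = (X * Y) * (X * Y - S) *+ 2 by ring.
by rewrite pmulrn_lge0// pmulr_rge0// subr_ge0.
Qed.

Lemma sqr_vnormD d (x y : 'cV[R]_d) :
  vnorm (x + y) ^+ 2 = vnorm x ^+ 2 + (\sum_j x j 0 * y j 0) *+ 2 + vnorm y ^+ 2.
Proof.
rewrite !sqr_vnorm -sumrMnl -!big_split /=; apply: eq_bigr => j _.
by rewrite mxE sqrrD.
Qed.

Lemma ler_vnormD d (x y : 'cV[R]_d) : vnorm (x + y) <= vnorm x + vnorm y.
Proof.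
rewrite -(@ler_pXn2r _ 2)// ?nnegrE ?addr_ge0 ?vnorm_ge0//.
by rewrite sqr_vnormD sqrrD lerD2r lerD2l lerMn2r vnorm_CauchySchwarz orbT.
Qed.

(* Flipping the sign of a coordinate of [y] preserves its norm but increases
   the inner product with [x]. *)
Lemma ltr_vnormD_opp_sign d (x y : 'cV[R]_d) j0 : x j0 0 * y j0 0 < 0 ->
  vnorm (x + y) < vnorm x + vnorm y.
Proof.
move=> xy0; rewrite -(@ltr_pXn2r _ 2)// ?nnegrE ?addr_ge0 ?vnorm_ge0//.
rewrite sqr_vnormD sqrrD ltrD2r ltrD2l ltrMn2r /=.
pose y' : 'cV[R]_d := \col_j (if j == j0 then - y j0 0 else y j 0).
have -> : vnorm y = vnorm y'.
  congr Num.sqrt; apply: eq_bigr => j _; rewrite mxE.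
  by case: eqP => // ->; rewrite sqrrN.
apply: lt_le_trans (vnorm_CauchySchwarz x y').
rewrite (bigD1 j0)//= [ltRHS](bigD1 j0)//= mxE eqxx mulrN.
rewrite [X in _ < _ + X](eq_bigr (fun j => x j 0 * y j 0)).
  by rewrite ltrD2r (lt_trans xy0)// oppr_gt0.
by move=> j jj0; rewrite mxE (negbTE jj0).
Qed.

Lemma ler_vnorm_sum (I : Type) (r : seq I) (Q : pred I) d (F : I -> 'cV[R]_d) :
  vnorm (\sum_(i <- r | Q i) F i) <= \sum_(i <- r | Q i) vnorm (F i).
Proof.
elim/big_ind2: _ => [|x1 x2 y1 y2 h1 h2|//].
  by rewrite vnorm0.
by apply: (le_trans (ler_vnormD _ _)); exact: lerD.
Qed.

Lemma vnorm_delta d (j : 'I_d) : vnorm (delta_mx j 0 : 'cV[R]_d) = 1.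
Proof.
rewrite /vnorm (bigD1 j)//= big1 => [|i ij]; first by rewrite !mxE !eqxx expr1n addr0 sqrtr1.
by rewrite mxE (negbTE ij) expr0n.
Qed.

(** This crude column bound does two jobs: it bounds the spectral norm from above, and it shows that
    the set under the [sup] is bounded. *)
Lemma mulmx_vnorm_le d (A : 'M[R]_d) (v : 'cV[R]_d) : vnorm v <= 1 ->
  vnorm (A *m v) <= \sum_j vnorm (A *m delta_mx j 0).
Proof.
move=> v1.
have -> : A *m v = \sum_j v j 0 *: (A *m delta_mx j 0).
  rewrite {1}[v](_ : _ = \sum_j v j 0 *: delta_mx j 0).
    by rewrite mulmx_sumr; apply: eq_bigr => j _; rewrite scalemxAr.
  apply/matrixP => i k; rewrite summxE (bigD1 i)//= big1 => [|j ji].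
    by rewrite !mxE !ord1 !eqxx mulr1 addr0.
  by rewrite !mxE eq_sym (negbTE ji) mulr0.
apply: (le_trans (ler_vnorm_sum _ _ _)); apply: ler_sum => j _.
by rewrite vnormZ ler_piMl ?vnorm_ge0// (le_trans (coord_le_vnorm _ _)).
Qed.

Lemma spec_norm_le d (A : 'M[R]_d) : spec_norm A <= \sum_j vnorm (A *m delta_mx j 0).
Proof.
apply: ge_sup => [|_ [v v1 <-]]; last exact: mulmx_vnorm_le.
exists (vnorm (A *m 0)); exists 0 => //=.
by rewrite vnorm0.
Qed.

Lemma le_spec_norm d (A : 'M[R]_d) v : vnorm v <= 1 -> vnorm (A *m v) <= spec_norm A.
Proof.
move=> v1; apply: ub_le_sup; last by exists v.
by exists (\sum_j vnorm (A *m delta_mx j 0)) => _ [u u1 <-]; exact: mulmx_vnorm_le.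
Qed.

(** Every term is at most the largest, whose power is one of the summands on the right. The loose
    constant is harmless, since its k-th root tends to 1. *)
Lemma powR_sum_le d (x : 'I_d.+1 -> R) s : 0 <= s -> (forall j, 0 <= x j) ->
  (\sum_j x j) `^ s <= d.+1%:R `^ s * \sum_j x j `^ s.
Proof.
move=> s0 x0.
have [i _ xi] := @arg_maxP _ _ _ (ord0 : 'I_d.+1) predT x isT.
have S0 : 0 <= \sum_j x j by exact: sumr_ge0.
apply: (@le_trans _ _ ((d.+1%:R * x i) `^ s)).
  apply: ge0_ler_powR; rewrite ?nnegrE ?mulr_ge0//.
  apply: (@le_trans _ _ (\sum_(j < d.+1) x i)); first by apply: ler_sum => j _; exact: xi.
  by rewrite sumr_const card_ord mulr_natl.
rewrite powRM// ler_wpM2l ?powR_ge0// (bigD1 i)//= lerDl.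
by apply: sumr_ge0 => j _; exact: powR_ge0.
Qed.

End EuclideanNorm.

Section RealInequalities.
Context {R : realType}.

(** Young's inequality for [t] and 1 with conjugate exponents s and s / (s - 1), multiplied by s. *)
Lemma powR_Bernoulli (t s : R) : 0 <= t -> 1 <= s -> 1 + s * (t - 1) <= t `^ s.
Proof.
move=> t0; rewrite le_eqVlt => /predU1P[<-|s1]; first by rewrite powRr1//; lra.
have s0 : 0 < s by lra.
have q0 : 0 < 1 - s^-1 by rewrite subr_gt0 invf_lt1.
have := @conjugate_powR _ t 1 s (1 - s^-1)^-1 t0 ler01 s0.
rewrite invr_gt0 q0 invrK addrCA subrr addr0 powR1 mulr1 mul1r => /(_ isT erefl).
rewrite -(ler_pM2l s0) mulrDr mulrCA divff ?gt_eqF// mulr1 mulrBr mulr1 divff ?gt_eqF//.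
by move=> h; lra.
Qed.

Lemma powR_le_chord (x t : R) : 0 <= x -> 0 < t -> t <= 1 -> x `^ t <= 1 - t + t * x.
Proof.
move=> x0 t0 t1.
have := @powR_Bernoulli (x `^ t) t^-1 (powR_ge0 _ _).
rewrite invf_ge1// t1 -powRrM divff ?gt_eqF// powRr1// => /(_ isT).
rewrite -(ler_pM2l t0) mulrDr mulrA divff ?gt_eqF// mul1r mulr1.
by move=> h; lra.
Qed.

(* The tangent line of [x `^ s] at the barycentre supports it from below. *)
Lemma powR_Jensen (I : finType) (w x : I -> R) s : 1 <= s ->
  (forall i, 0 <= w i) -> \sum_i w i = 1 -> (forall i, 0 <= x i) ->
  (\sum_i w i * x i) `^ s <= \sum_i w i * x i `^ s.
Proof.
move=> s1 w0 w1 x0; set m := \sum_i w i * x i.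
have m0 : 0 <= m by apply: sumr_ge0 => i _; rewrite mulr_ge0.
have s0 : s != 0 by rewrite gt_eqF//; lra.
(* The tangent argument normalises by [m]. *)
have [->|m1] := eqVneq m 0.
  by rewrite powR0//; apply: sumr_ge0 => i _; rewrite mulr_ge0// powR_ge0.
have mgt0 : 0 < m by rewrite lt0r m1.
apply: (@le_trans _ _ (\sum_i w i * (m `^ s * (1 + s * (x i / m - 1))))).
  have -> : \sum_i w i * (m `^ s * (1 + s * (x i / m - 1))) =
      m `^ s * ((1 - s) * \sum_i w i + s / m * m).
    rewrite {4}/m !mulr_sumr -big_split mulr_sumr /=; apply: eq_bigr => i _; ring.
  by rewrite w1 divfK// mulr1 subrK mulr1.
apply: ler_sum => i _; apply: ler_wpM2l => //.
rewrite -{2}(divfK m1 (x i)) powRM// ?divr_ge0// mulrC ler_wpM2r ?powR_ge0//.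
by apply: powR_Bernoulli; rewrite ?divr_ge0.
Qed.

End RealInequalities.

(* Spares proving that the spectral norm is measurable. *)
Lemma ge0_le_integral_nonmeasurable {R : realType} {dT} {T : measurableType dT}
  (mu : {measure set T -> \bar R}) (f g : T -> \bar R) :
  (forall x, 0 <= f x)%E -> (forall x, f x <= g x)%E ->
  (\int[mu]_x f x <= \int[mu]_x g x)%E.
Proof.
move=> f0 fg.
rewrite !ge0_integralTE// => [|x]; last exact: le_trans (fg x).
by apply: ereal_sup_le => _ [h hf <-]; exists h => // x; exact: le_trans (fg x).
Qed.

Lemma sume_const_ord {R : realType} n (x : \bar R) : (0 <= x)%E ->
  (\sum_(j < n) x = n%:R%:E * x)%E.
Proof.
move=> x0; elim: n => [|n IH]; first by rewrite big_ord0 mul0e.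
by rewrite big_ord_recr IH /= -natr1 EFinD ge0_muleDl ?mul1e ?lee_fin.
Qed.

Lemma cvg_powR_invn {R : realType} (K : R) : 0 < K ->
  (fun k => K `^ (k%:R^-1)) @ \oo --> (1 : R).
Proof.
move=> K0.
rewrite (_ : (fun k : nat => K `^ k%:R^-1) = (fun k => expR (k%:R^-1 * ln K))); last first.
  by apply/funext => k; rewrite /powR gt_eqF.
have : expR (k%:R^-1 * ln K) @[k --> \oo] --> expR (0 * ln K).
  apply: continuous_cvg; first exact: continuous_expR.
  apply: cvgMl.
  apply/gtr0_cvgV0; first by near=> k; rewrite ltr0n; near: k; exact: nbhs_infty_gt.
  exact: cvgr_idn.
by rewrite mul0r expR0.
Unshelve. all: by end_near. Qed.

Lemma spec_norm_ge0 {R : realType} d (A : 'M[R]_d) : 0 <= spec_norm A.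
Proof.
apply: (le_trans (vnorm_ge0 (A *m 0))).
by apply: le_spec_norm; rewrite vnorm0.
Qed.

(** * From the tail-index to the one-step moment *)

Section TailIndexMoment.
Context {R : realType} {dT : measure_display} {T : measurableType dT}.
Variables (P : probability T R) (Z : nat -> nat -> T -> R).
Hypothesis iidZ : iid_std_normal P Z.

Lemma moment_ge0 c d b s : (0 <= moment P Z c d b s)%E.
Proof. by apply: integral_ge0 => w _; exact: powR_EFin_ge0. Qed.

(** The spectral norm is tested on the single unit vector e_0. *)
Lemma spec_moment_ge eta var b d s k : 0 <= var -> 0 < s ->
  (moment P Z (eta / b%:R * var) d b s ^+ k <=
   \int[P]_w (spec_norm (Pimat Z eta var b d.+1 k w) `^ s)%:E)%E.
Proof.
move=> v0 s0; have := integral_pmx iidZ (eta / b%:R * var) b k s (delta_mx (0 : 'I_d.+1) 0).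
rewrite vnorm_delta powR1 mul1e => <-.
apply: ge0_le_integral_nonmeasurable => w; first exact: powR_EFin_ge0.
rewrite Pimat_pmx// lee_fin; apply: ge0_ler_powR;
  rewrite ?nnegrE ?vnorm_ge0 ?spec_norm_ge0 ?(ltW s0)//.
by apply: le_spec_norm; rewrite vnorm_delta.
Qed.

(** The norm is bounded by the sum over columns, and by isotropy every column has the same
    moment. *)
Lemma spec_moment_le eta var b d s k : 0 <= var -> 0 < s ->
  (\int[P]_w (spec_norm (Pimat Z eta var b d.+1 k w) `^ s)%:E <=
   (d.+1%:R `^ s * d.+1%:R)%:E * moment P Z (eta / b%:R * var) d b s ^+ k)%E.
Proof.
move=> v0 s0; set c := eta / b%:R * var.
pose f (j : 'I_d.+1) w := (vnorm (pmx c d.+1 b k (fun i j => Z i j w) *m delta_mx j 0) `^ s)%:E.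
have mf j : measurable_fun setT (f j).
  apply: measurable_vnorm_powR; apply: measurable_mxM; last exact: measurable_mx_cst.
  apply: (@measurable_pmx R _ _ c d.+1 b k (fun w i j => Z i j w)).
  exact: measurable_iid iidZ.
apply: (@le_trans _ _ (\int[P]_w ((d.+1%:R `^ s)%:E * \sum_j f j w))%E).
  apply: ge0_le_integral_nonmeasurable => w; first exact: powR_EFin_ge0.
  rewrite Pimat_pmx// sumEFin -EFinM lee_fin.
  apply: le_trans (powR_sum_le (ltW s0) (fun j => vnorm_ge0 _)).
  apply: ge0_ler_powR; rewrite ?nnegrE ?(ltW s0) ?spec_norm_ge0//; last exact: spec_norm_le.
  by apply: sumr_ge0 => j _; exact: vnorm_ge0.
rewrite ge0_integralZl//=; last 2 first.
- exact: emeasurable_sum.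
- by move=> w _; apply: sume_ge0 => j _; exact: powR_EFin_ge0.
rewrite ge0_integral_sum//; last by move=> j w _; exact: powR_EFin_ge0.
rewrite (eq_bigr (fun=> moment P Z c d b s ^+ k)%E); last first.
  by move=> j _; rewrite /f integral_pmx// vnorm_delta powR1 mul1e.
rewrite EFinM -muleA; apply: lee_wpmul2l; first by rewrite lee_fin powR_ge0.
by rewrite sume_const_ord// expe_ge0// moment_ge0.
Qed.

(** Squeeze: [hseq] lies between m and K^(1/k) m and tends to 1. *)
Lemma tail_index_moment eta var b d alpha : 0 <= var ->
  tail_index P Z eta var b d.+1 alpha ->
  (0 < alpha) /\ moment P Z (eta / b%:R * var) d b alpha = 1%E.
Proof.
move=> v0 [a0 hl]; split=> //.
set m := moment _ _ _ _ _ _; have m0 : (0 <= m)%E by exact: moment_ge0.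
(* At [k = 0] the exponent is 0, whence [0 < k]. The case m = +oo is treated because finiteness is
   only derived below. *)
have mX (k : nat) : (0 < k)%N -> poweR (m ^+ k)%E k%:R^-1 = m.
  case: k => // k _; move: m0; case: m => [r|_|//].
    rewrite lee_fin => r0; rewrite -EFin_expe poweR_EFin -powR_mulrn// -powRrM.
    by rewrite divff ?pnatr_eq0// powRr1.
  have -> : (+oo ^+ k.+1 = +oo :> \bar R)%E.
    by elim: k => [|k IH]; rewrite expeS ?expe0 ?mule1// IH mulyy.
  by rewrite poweRyr// invr_eq0 pnatr_eq0.
have low (k : nat) : (0 < k)%N -> (m <= hseq P Z eta var b d.+1 alpha k)%E.
  move=> k0; rewrite -[leLHS](mX k k0); apply: gt0_ler_poweR.
  - by rewrite invr_ge0.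
  - by rewrite in_itv /= leey expe_ge0.
  - by rewrite in_itv /= leey andbT; apply: integral_ge0 => w _; exact: powR_EFin_ge0.
  - exact: spec_moment_ge.
set K := d.+1%:R `^ alpha * d.+1%:R.
have K0 : 0 < K by rewrite mulr_gt0// powR_gt0.
have up (k : nat) : (0 < k)%N ->
    (hseq P Z eta var b d.+1 alpha k <= (K `^ k%:R^-1)%:E * m)%E.
  move=> k0; rewrite -[in leRHS](mX k k0) -poweR_EFin -poweRM; last 2 first.
  - by rewrite lee_fin ltW.
  - by rewrite expe_ge0.
  apply: gt0_ler_poweR.
  - by rewrite invr_ge0.
  - by rewrite in_itv /= leey andbT; apply: integral_ge0 => w _; exact: powR_EFin_ge0.
  - by rewrite in_itv /= leey andbT mule_ge0// ?expe_ge0// lee_fin ltW.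
  - exact: spec_moment_le.
(* The lower bound alone gives m <= 1, hence finiteness, which is what makes K^(1/k) m converge to
   m. *)
have m1 : (m <= 1)%E.
  by apply: (cvge_to_ge hl); near=> k; apply: low; near: k; exact: nbhs_infty_gt.
apply/eqP; rewrite eq_le m1 /=.
have mfin : m \is a fin_num by rewrite ge0_fin_numE// (le_lt_trans m1) ?ltry.
have hu : (fun k : nat => ((K `^ k%:R^-1)%:E * m)%E) @ \oo --> m.
  rewrite -(fineK mfin) -[X in _ --> X]mul1e.
  apply: cvg_EFin.
    by near=> k.
  by apply: cvgMl; exact: cvg_powR_invn.
apply: (lee_cvg_to hl hu).
by near=> k; apply: up; near: k; exact: nbhs_infty_gt.
Unshelve. all: by end_near. Qed.

End TailIndexMoment.

(** If the integrals were equal, g - f would have integral 0 and vanish almost everywhere,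
    contradicting the positive mass of [N]. *)
Lemma ge0_integral_lt {R : realType} {dT} {T : measurableType dT}
  (P : {measure set T -> \bar R}) (f g : T -> R) (N : set T) :
  measurable_fun setT f -> measurable_fun setT g ->
  (forall w, 0 <= f w) -> (forall w, f w <= g w) ->
  (\int[P]_w (g w)%:E < +oo)%E ->
  measurable N -> (0 < P N)%E -> (forall w, N w -> f w < g w) ->
  (\int[P]_w (f w)%:E < \int[P]_w (g w)%:E)%E.
Proof.
move=> mf mg f0 fg goo mN N0 fgN.
have mfe : measurable_fun setT (fun w => (f w)%:E) by exact/measurable_EFinP.
have mh : measurable_fun setT (fun w => (g w - f w)%:E).
  by apply/measurable_EFinP; exact: measurable_funB.
have h0 w : (0 <= (g w - f w)%:E)%E by rewrite lee_fin subr_ge0.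
have gE : (\int[P]_w (g w)%:E = \int[P]_w (f w)%:E + \int[P]_w (g w - f w)%:E)%E.
  rewrite -ge0_integralD//; last by move=> w _; rewrite lee_fin.
  by apply: eq_integral => w _; rewrite -EFinD addrCA subrr addr0.
have If0 : (0 <= \int[P]_w (f w)%:E)%E by apply: integral_ge0 => w _; rewrite lee_fin.
have Ih0 : (0 <= \int[P]_w (g w - f w)%:E)%E by exact: integral_ge0.
have foo : (\int[P]_w (f w)%:E)%E \is a fin_num.
  by rewrite ge0_fin_numE// (le_lt_trans _ goo)// gE leeDl.
rewrite gE lteDl// lt0e Ih0 andbT; apply/negP => /eqP h_eq0.
have /(ae_eq_integral_abs _ measurableT mh) [A [mA A0 NA]] :
    (\int[P]_(w in setT) `|(g w - f w)%:E| = 0)%E.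
  by rewrite -[RHS]h_eq0; apply: eq_integral => w _; rewrite gee0_abs.
suff : (P N <= P A)%E by rewrite A0 leNgt N0.
apply: le_measure; rewrite ?inE// => w Nw; apply: NA => /= /(_ I)/eqP.
by rewrite eqe subr_eq0 gt_eqF// fgN.
Qed.

Lemma normal_prob_itv_gt0 {R : realType} (a b : R) : a < b ->
  (0 < normal_prob 0 1 `]a, b[%classic)%E.
Proof.
(* [M] dominates |x| on the interval, so [C] is a positive lower bound of the density there. *)
move=> ab; pose M := `|a| + `|b|.
pose C := @normal_peak R 1 * expR (- M ^+ 2 / (1 ^+ 2 *+ 2)).
have C0 : 0 < C by rewrite mulr_gt0 ?expR_gt0// normal_peak_gt0 ?oner_eq0.
apply: (@lt_le_trans _ _ (\int[lebesgue_measure]_(x in `]a, b[%classic) C%:E)%E).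
  rewrite integral_cst//= lebesgue_measure_itv/= lte_fin ab -EFinB -EFinM lte_fin.
  by rewrite mulr_gt0// subr_gt0.
apply: ge0_le_integral => //=.
- by move=> x _; rewrite lee_fin ltW.
- by apply/measurable_EFinP/measurable_funTS; exact: measurable_normal_pdf.
move=> x; rewrite in_itv /= => /andP[ax xb].
rewrite lee_fin normal_pdfE ?oner_eq0// /normal_fun ler_wpM2l ?normal_peak_ge0//.
rewrite ler_expR subr0 ler_pM2r ?invr_gt0 ?expr1n// lerN2.
rewrite -[x ^+ 2]real_normK ?num_real// ler_pXn2r ?nnegrE ?addr_ge0//.
rewrite ler_norml /M; have := ler_norm b; have := ler_norm (- a).
by rewrite normrN => h1 h2; apply/andP; split; have := normr_ge0 a; have := normr_ge0 b; lra.
Qed.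

(** * Strict monotonicity of the one-step moment *)

Section Strict.
Context {R : realType} {dT : measure_display} {T : measurableType dT}.
Variables (P : probability T R) (Z : nat -> nat -> T -> R).
Hypothesis iidZ : iid_std_normal P Z.

Local Notation path w := (fun i j => Z i j w).
Local Notation box s B := (\bigcap_(p in [set` s]) (Z p.1 p.2 @^-1` B p)).

Lemma measurable_box (s : seq (nat * nat)) (B : nat * nat -> set R) :
  (forall p, measurable (B p)) -> measurable (box s B).
Proof.
move=> mB; apply: measurable_bigcap_seq => p.
by rewrite -[X in measurable X]setTI; exact: measurable_iid iidZ _ _ _ _ _.
Qed.

(** Source of the positive-probability events on which the inequalities are strict. *)
Lemma box_gt0 (s : seq (nat * nat)) (B : nat * nat -> set R) :
  uniq s -> (forall p, measurable (B p)) -> (forall p, 0 < normal_prob 0 1 (B p))%E ->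
  (0 < P (box s B))%E.
Proof.
move=> us mB B0; have [_ g ->//] := iidZ.
apply: (big_ind (fun x : \bar R => 0 < x)%E) => [|x y x0 y0|p _].
- exact: lte01.
- exact: mule_gt0.
- by rewrite g.
Qed.

Lemma moment_lt1_le c d b s s' : 0 < s' -> s' <= s ->
  (moment P Z c d b s < 1)%E -> (moment P Z c d b s' < 1)%E.
Proof.
move=> s0' ss' m1; have s0 : 0 < s by exact: lt_le_trans ss'.
pose t := s' / s; have t0 : 0 < t by rewrite divr_gt0.
have t1 : t <= 1 by rewrite ler_pdivrMr// mul1r.
pose f w := vnorm (smx c d.+1 b (path w) *m delta_mx 0 0).
have mf p : measurable_fun setT (fun w => (f w `^ p)%:E).
  by apply: measurable_smx_path; exact: measurable_iid iidZ.
have mfin : moment P Z c d b s \is a fin_num.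
  by rewrite ge0_fin_numE ?moment_ge0// (lt_trans m1)// ltry.
apply: (@le_lt_trans _ _ (\int[P]_w ((1 - t)%:E + t%:E * (f w `^ s)%:E))%E).
  apply: ge0_le_integral_nonmeasurable => w; first exact: powR_EFin_ge0.
  rewrite -EFinM -EFinD lee_fin (_ : s' = s * t); last by rewrite /t mulrCA divff ?mulr1// gt_eqF.
  by rewrite powRrM; apply: powR_le_chord => //; exact: powR_ge0.
rewrite ge0_integralD//; last 3 first.
- by move=> w _; rewrite lee_fin subr_ge0.
- by move=> w _; rewrite mule_ge0 ?powR_EFin_ge0// lee_fin ltW.
- exact: emeasurable_funM.
rewrite integral_cst//= probability_setT mule1 ge0_integralZl//; last 2 first.
- by move=> w _; exact: powR_EFin_ge0.
- by rewrite lee_fin ltW.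
rewrite -[X in (_ * X)%E]/(moment P Z c d b s).
move: m1 mfin; case: (moment _ _ _ _ _ _) => [m|//|//]; rewrite lte_fin => m1 _.
by rewrite -EFinM -EFinD lte_fin; nra.
Qed.

Lemma lt_of_moment_lt1 c d b s s' : 0 < s' ->
  (moment P Z c d b s < 1)%E -> moment P Z c d b s' = 1%E -> s < s'.
Proof.
move=> s0' m1 m'1; rewrite ltNge; apply/negP => ss'.
by have := moment_lt1_le s0' ss' m1; rewrite m'1 ltxx.
Qed.

End Strict.

Section ConvexVnorm.
Context {R : realType} (I : finType) (d : nat).
Variables (w : I -> R) (u : I -> 'cV[R]_d) (s : R).
Hypotheses (s1 : 1 <= s) (w0 : forall i, 0 <= w i) (w1 : \sum_i w i = 1).

Lemma vnorm_wsum_le : vnorm (\sum_i w i *: u i) <= \sum_i w i * vnorm (u i).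
Proof.
apply: (le_trans (ler_vnorm_sum _ _ _)); apply: ler_sum => i _.
by rewrite vnormZ ger0_norm.
Qed.

(** One strict triangle inequality, between the opposing terms [i] and [k], is enough; the other
    terms use the ordinary one. *)
Lemma vnorm_wsum_lt i k j : 0 < w i -> 0 < w k -> u i j 0 * u k j 0 < 0 ->
  vnorm (\sum_i w i *: u i) < \sum_i w i * vnorm (u i).
Proof.
move=> wi wk uik.
have ik : k != i.
  by apply/eqP => e; move: uik; rewrite e -expr2 ltNge sqr_ge0.
rewrite (bigD1 i)//= (bigD1 k)//= addrA [ltRHS](bigD1 i)//= [X in _ < _ + X](bigD1 k)//= addrA.
apply: (le_lt_trans (ler_vnormD _ _)); apply: ltr_leD.
  rewrite -[X in X * vnorm (u i)](gtr0_norm wi) -[X in X * vnorm (u k)](gtr0_norm wk) -!vnormZ.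
  by apply: (@ltr_vnormD_opp_sign _ _ _ _ j); rewrite !mxE mulrACA pmulr_rlt0// mulr_gt0.
apply: (le_trans (ler_vnorm_sum _ _ _)); apply: ler_sum => l _.
by rewrite vnormZ ger0_norm.
Qed.

Let S0 : 0 <= \sum_i w i * vnorm (u i).
Proof. by apply: sumr_ge0 => i _; rewrite mulr_ge0// vnorm_ge0. Qed.

Lemma vnorm_powR_convex :
  vnorm (\sum_i w i *: u i) `^ s <= \sum_i w i * vnorm (u i) `^ s.
Proof.
apply: le_trans (powR_Jensen s1 w0 w1 (fun i => vnorm_ge0 (u i))).
by apply: ge0_ler_powR; rewrite ?nnegrE ?vnorm_ge0 ?vnorm_wsum_le ?S0// (le_trans ler01 s1).
Qed.

Lemma vnorm_powR_strict_convex i k j : 0 < w i -> 0 < w k -> u i j 0 * u k j 0 < 0 ->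
  vnorm (\sum_i w i *: u i) `^ s < \sum_i w i * vnorm (u i) `^ s.
Proof.
move=> wi wk uik.
apply: lt_le_trans (powR_Jensen s1 w0 w1 (fun i => vnorm_ge0 (u i))).
apply: gt0_ltr_powR; rewrite ?nnegrE ?vnorm_ge0 ?S0 ?(lt_le_trans ltr01 s1)//.
exact: vnorm_wsum_lt uik.
Qed.

End ConvexVnorm.

Section Monotone.
Context {R : realType} {dT : measure_display} {T : measurableType dT}.
Variables (P : probability T R) (Z : nat -> nat -> T -> R).
Hypothesis iidZ : iid_std_normal P Z.

Local Notation path w := (fun i j => Z i j w).
Local Notation box s B := (\bigcap_(p in [set` s]) (Z p.1 p.2 @^-1` B p)).

Lemma smx_e0 c d b (u : nat -> nat -> R) (j : 'I_d.+1) :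
  (smx c d.+1 b u *m delta_mx 0 0 : 'cV_d.+1) j 0 =
  (j == 0)%:R - c * \sum_(i < b) u i j * u i 0%N.
Proof.
rewrite mxE (bigD1 0)//= big1 => [|k k0]; last by rewrite [delta_mx _ _ _ _]mxE (negbTE k0) mulr0.
rewrite [delta_mx _ _ _ _]mxE !eqxx mulr1 addr0 /smx !mxE summxE; congr (_ - c * _).
by apply: eq_bigr => i _; rewrite mxE big_ord1 !mxE.
Qed.

Lemma measurable_step c d b s (f : nat -> nat) :
  measurable_fun setT
    (fun w => vnorm (smx c d.+1 b (fun i j => Z (f i) j w) *m delta_mx 0 0) `^ s).
Proof.
apply/measurable_EFinP.
apply: (measurable_smx_path (Y := fun i j => Z (f i) j)) => i j.
exact: (measurable_iid iidZ (f i) j).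
Qed.

(** Common core of the stepsize and batch arguments: the step vector is a pathwise convex
    combination of step vectors whose moments are known after relabelling samples by [f i], and [N]
    provides strictness. *)
Lemma moment_convex_lt (I : finType) (wt : I -> R) (c' : R) (b' : nat)
    (c : I -> R) (b : I -> nat) (f : I -> nat -> nat) d s (N : set T) :
  1 <= s -> (forall i, 0 < wt i) -> \sum_i wt i = 1 ->
  (forall w, smx c' d.+1 b' (path w) *m delta_mx 0 0 =
     \sum_i wt i *: (smx (c i) d.+1 (b i) (fun l j => Z (f i l) j w) *m delta_mx 0 0
        : 'cV_d.+1)) ->
  (forall i, injective (f i)) ->
  measurable N -> (0 < P N)%E ->
  (forall w, N w -> exists i k,
     (smx (c i) d.+1 (b i) (fun l j => Z (f i l) j w) *m delta_mx 0 0 : 'cV_d.+1) 0 0 *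
     (smx (c k) d.+1 (b k) (fun l j => Z (f k l) j w) *m delta_mx 0 0 : 'cV_d.+1) 0 0 < 0) ->
  (\sum_i (wt i)%:E * moment P Z (c i) d (b i) s < +oo)%E ->
  (moment P Z c' d b' s < \sum_i (wt i)%:E * moment P Z (c i) d (b i) s)%E.
Proof.
move=> s1 w0 w1 E finj mN N0 HN.
pose u i w : 'cV_d.+1 := smx (c i) d.+1 (b i) (fun l j => Z (f i l) j w) *m delta_mx 0 0.
have mu i : measurable_fun setT (fun w => vnorm (u i w) `^ s) by exact: measurable_step.
have mom i : (\int[P]_w (vnorm (u i w) `^ s)%:E = moment P Z (c i) d (b i) s)%E.
  have mF := measurable_smx_path (S := pathT R) (Y := fun i j (u : pathT R) => u i j)
    (c i) (b i) s (delta_mx (0 : 'I_d.+1) 0) measurable_coord.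
  exact: (law_rows iidZ (finj i) mF (fun u => powR_EFin_ge0 _ _)).
have -> : (\sum_i (wt i)%:E * moment P Z (c i) d (b i) s =
    \int[P]_w (\sum_i wt i * vnorm (u i w) `^ s)%:E)%E.
  under [RHS]eq_integral do rewrite -sumEFin.
  rewrite ge0_integral_sum//; last 2 first.
  - by move=> i; apply/measurable_EFinP; exact: measurable_funM.
  - by move=> i w _; rewrite lee_fin mulr_ge0// ?powR_ge0// ltW.
  apply: eq_bigr => i _; rewrite -mom -ge0_integralZl//; last 3 first.
  - exact/measurable_EFinP.
  - by move=> w _; exact: powR_EFin_ge0.
  - by rewrite lee_fin ltW.
move=> goo; apply: (ge0_integral_lt _ _ _ _ goo mN N0).
- exact: (measurable_step c' d b' s id).
- by apply: measurable_sum => i; exact: measurable_funM.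
- by move=> w; exact: powR_ge0.
- move=> w; rewrite E; apply: vnorm_powR_convex => // i; exact: ltW.
- move=> w Nw; have [i [k ik]] := HN w Nw.
  by rewrite E; apply: (vnorm_powR_strict_convex s1 _ w1 (w0 i) (w0 k) ik) => l; exact: ltW.
Qed.

Lemma moment_lt_step c1 c2 d b s : 0 < c1 -> c1 < c2 -> (0 < b)%N -> 1 <= s ->
  moment P Z c2 d b s = 1%E -> (moment P Z c1 d b s < 1)%E.
Proof.
move=> c10 c12 b0 s1 m1; have c20 : 0 < c2 by lra.
(* c1 = lam c2 + (1 - lam) 0, and at c = 0 the moment is 1. *)
pose lam := c1 / c2.
have lam0 : 0 < lam by rewrite divr_gt0.
have lam1 : lam < 1 by rewrite ltr_pdivrMr// mul1r.
pose wt (i : bool) := if i then lam else 1 - lam.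
pose c (i : bool) := if i then c2 else 0.
have m0 : moment P Z 0 d b s = 1%E.
  rewrite /moment (eq_integral (fun=> 1%E)); last first.
    by move=> w _; rewrite /smx scale0r subr0 mul1mx vnorm_delta powR1.
  by rewrite integral_cst//= probability_setT mule1.
have S1 : (\sum_i (wt i)%:E * moment P Z (c i) d b s = 1)%E.
  by rewrite big_bool /= m0 m1 !mule1 -EFinD addrC subrK.
(* For z > K one has z^2 > K, as K > 1, and c2 K > 1. So the e_0-coordinate is negative at c2,
   against 1 at c = 0. *)
pose K := 1 + c2^-1.
pose B := fun _ : nat * nat => `]K, (K + 1)[%classic : set R.
rewrite -S1; apply: (@moment_convex_lt bool wt c1 b c (fun=> b) (fun=> id) d s
   (box [:: (0%N, 0%N)] B)) => //.
- by case; rewrite /wt// subr_gt0.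
- by rewrite big_bool /= addrC subrK.
- move=> w; apply/matrixP => j l; rewrite ord1 summxE big_bool /= smx_e0.
  rewrite [X in _ = X + _]mxE [X in _ = _ + X]mxE !smx_e0 mul0r subr0 /lam.
  have c2n : c2 != 0 by rewrite gt_eqF.
  by field.
- by move=> _; exact: inj_id.
- by apply: (measurable_box iidZ) => p; exact: measurable_itv.
- apply: (box_gt0 iidZ) => // p; first exact: measurable_itv.
  by apply: normal_prob_itv_gt0; lra.
- move=> w Nw; exists true, false; rewrite !smx_e0 /= mul0r subr0 mulr1.
  have := Nw (0%N, 0%N); rewrite /= inE => /(_ erefl).
  rewrite /B/= in_itv /= => /andP[KZ _].
  rewrite subr_lt0 (bigD1 (Ordinal b0))//= mulrDr.
  apply: (@lt_le_trans _ _ (c2 * (Z 0 0 w * Z 0 0 w))).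
    have K0 : 1 < K by rewrite /K ltrDl invr_gt0.
    have h : 1 < c2 * K by rewrite /K mulrDr mulr1 divff ?gt_eqF// ltrDr.
    have h2 : K < Z 0%N 0%N w * Z 0%N 0%N w by nra.
    by apply: (lt_trans h); rewrite ltr_pM2l.
  rewrite lerDl mulr_ge0 ?(ltW c20)//; apply: sumr_ge0 => i _.
  by rewrite -expr2 sqr_ge0.
- by rewrite S1 ltry.
Qed.

Lemma moment_succ_batch kappa b d s : 0 < kappa -> (0 < b)%N -> 1 <= s ->
  (moment P Z (kappa / b%:R) d b s < +oo)%E ->
  (moment P Z (kappa / b.+1%:R) d b.+1 s < moment P Z (kappa / b%:R) d b s)%E.
Proof.
move=> k0 b0 s1 moo; set c := kappa / b%:R.
have bR : 0 < b%:R :> R by rewrite ltr0n.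
have c0 : 0 < c by rewrite divr_gt0.
pose wt (_ : 'I_b.+1) : R := b.+1%:R^-1.
have S1 : (\sum_(i < b.+1) (wt i)%:E * moment P Z c d b s = moment P Z c d b s)%E.
  rewrite /wt sume_const_ord ?mule_ge0 ?moment_ge0 ?lee_fin ?invr_ge0//.
  by rewrite muleA -EFinM divff ?mul1e// pnatr_eq0.
(* Sample 0 is large and the others small. A batch containing sample 0 has negative e_0-coordinate;
   the batch omitting it has a positive one, since each of its [b] squares is at most [del] and c b
   del < 1. *)
pose K := 1 + c^-1; pose del := (1 + c * b%:R)^-1.
have cb0 : 0 < c * b%:R by rewrite mulr_gt0.
have del0 : 0 < del by rewrite invr_gt0; lra.
have cbdel : c * b%:R * del < 1 by rewrite /del ltr_pdivrMr ?mul1r; lra.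
have del1 : del < 1 by rewrite invf_lt1; lra.
pose B (p : nat * nat) : set R :=
  if p.1 == 0%N then `]K, (K + 1)[%classic else `](- del), del[%classic.
pose q := [seq (i, 0%N) | i <- iota 0 b.+1].
rewrite -S1; apply: (@moment_convex_lt 'I_b.+1 wt _ b.+1 (fun=> c) (fun=> b)
   (fun i => bump i) d s (box q B)) => //.
- by move=> i; rewrite invr_gt0 ltr0n.
- by rewrite sumr_const card_ord /wt -[LHS]mulr_natr mulVf// pnatr_eq0.
- move=> w; apply/matrixP => j l; rewrite ord1 summxE smx_e0.
  under [RHS]eq_bigr do rewrite mxE smx_e0.
  rewrite -mulr_sumr sumrB sumr_const card_ord -mulr_sumr.
  pose F (i : 'I_b.+1) := Z i j w * Z i 0%N w.
  (* Each sample survives in [b] of the [b.+1] leave-one-out batches; this factor turns kappa / b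
     into kappa / (b + 1) after averaging. *)
  have -> : \sum_(i < b.+1) \sum_(l < b) Z (bump i l) j w * Z (bump i l) 0%N w =
      b%:R * \sum_i F i.
    rewrite (eq_bigr (fun i => \sum_k F k - F i)); last first.
      by move=> i _; rewrite (bigD1_ord i)//= addrAC subrr add0r.
    rewrite sumrB sumr_const card_ord; set S := \sum_i F i.
    by rewrite -[S *+ _]mulr_natr -natr1; ring.
  rewrite /c /wt -[_ *+ b.+1]mulr_natr -natr1.
  have b1 : b%:R + 1 != 0 :> R by rewrite gt_eqF//; lra.
  have b1' : b%:R != 0 :> R by rewrite gt_eqF.
  by rewrite /F; field; rewrite b1 b1'.
- by move=> i; exact: can_inj (bumpK i).
- by apply: (measurable_box iidZ) => p; rewrite /B; case: ifP.
- apply: (box_gt0 iidZ) => [|p|p].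
  + by rewrite map_inj_uniq ?iota_uniq// => i k [].
  + by rewrite /B; case: ifP.
  + by rewrite /B; case: ifP => _; apply: normal_prob_itv_gt0; lra.
- move=> w Nw.
  have Zlarge : 1 < c * (Z 0%N 0%N w * Z 0%N 0%N w).
    have := Nw (0%N, 0%N); rewrite /= (map_f (fun i => (i, 0%N)))// => /(_ erefl).
    rewrite /B/= in_itv /= => /andP[KZ _].
    have K0 : 1 < K by rewrite /K ltrDl invr_gt0.
    have h : 1 < c * K by rewrite /K mulrDr mulr1 divff ?gt_eqF// ltrDr.
    have h2 : K < Z 0%N 0%N w * Z 0%N 0%N w by nra.
    by apply: (lt_trans h); rewrite ltr_pM2l.
  have Zsmall i : (0 < i)%N -> (i <= b)%N -> Z i 0%N w * Z i 0%N w <= del.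
    move=> i0 ib; have := Nw (i, 0%N).
    rewrite /= (map_f (fun i => (i, 0%N))) ?mem_iota// => /(_ erefl).
    by rewrite /B/= gtn_eqF//= in_itv /= => /andP[z1 z2]; nra.
  have b1 : (1 < b.+1)%N by [].
  (* The batches omitting sample 0 and sample 1; the latter still contains sample 0. *)
  exists ord0, (Ordinal b1); rewrite !smx_e0 /= pmulr_rlt0.
    rewrite subr_lt0 (bigD1 (Ordinal b0))//= mulrDr.
    apply: (lt_le_trans Zlarge); rewrite lerDl mulr_ge0 ?(ltW c0)//.
    by apply: sumr_ge0 => i _; rewrite -expr2 sqr_ge0.
  rewrite subr_gt0; apply: le_lt_trans cbdel; rewrite -mulrA ler_pM2l//.
  apply: (@le_trans _ _ (\sum_(i < b) del)).
    by apply: ler_sum => i _; apply: Zsmall; rewrite ?bump_ltS// /bump /=.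
  by rewrite sumr_const card_ord mulr_natl.
- by rewrite S1.
Qed.

Lemma moment_lt_batch kappa b1 b2 d s : 0 < kappa -> (0 < b1)%N -> (b1 < b2)%N ->
  1 <= s -> (moment P Z (kappa / b1%:R) d b1 s < +oo)%E ->
  (moment P Z (kappa / b2%:R) d b2 s < moment P Z (kappa / b1%:R) d b1 s)%E.
Proof.
move=> k0 b10 + s1 moo; elim: b2 => // b2 IH; rewrite ltnS leq_eqVlt => /predU1P[<-|b12].
  exact: moment_succ_batch.
have lt2 := IH b12.
have b20 : (0 < b2)%N by exact: ltn_trans b12.
(* The inequality just obtained supplies the finiteness needed for the next increment. *)
have step := moment_succ_batch k0 b20 s1 (lt_trans lt2 moo).
exact: (lt_trans step lt2).
Qed.

(** Indexing by naturals makes the sum for a smaller dimension a prefix of the sum for a larger one,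
    on the same path. *)
Lemma vnorm_smx_e0 c d b (u : nat -> nat -> R) :
  vnorm (smx c d.+1 b u *m delta_mx 0 0) =
  Num.sqrt (\sum_(0 <= j < d.+1) ((j == 0%N)%:R - c * \sum_(i < b) u i j * u i 0%N) ^+ 2).
Proof.
rewrite /vnorm big_mkord; congr Num.sqrt; apply: eq_bigr => j _.
by rewrite smx_e0.
Qed.

Lemma moment_lt_dim c b d1 d2 s : 0 < c -> (0 < b)%N -> (d1 < d2)%N -> 0 < s ->
  (moment P Z c d2 b s < +oo)%E ->
  (moment P Z c d1 b s < moment P Z c d2 b s)%E.
Proof.
move=> c0 b0 d12 s0 moo.
(* Positive entries in columns 0 and [d1.+1], the first new coordinate, make their cross sum
   positive, so that coordinate is nonzero. *)
pose B := fun _ : nat * nat => `]0, 1[%classic : set R.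
pose q := [seq (i, j) | i <- iota 0 b, j <- [:: 0%N; d1.+1]].
pose G w j := ((j == 0%N)%:R - c * \sum_(i < b) Z i j w * Z i 0%N w) ^+ 2.
have G0 w j : 0 <= G w j by exact: sqr_ge0.
have split w : \sum_(0 <= j < d2.+1) G w j =
    \sum_(0 <= j < d1.+1) G w j + (G w d1.+1 + \sum_(d1.+2 <= j < d2.+1) G w j).
  have d12' : (d1.+1 <= d2.+1)%N by rewrite ltnS ltnW.
  rewrite (big_cat_nat (leq0n _) d12') /=; congr (_ + _).
  by rewrite big_ltn// ltnS.
have tail0 w : 0 <= \sum_(d1.+2 <= j < d2.+1) G w j by exact: sumr_ge0.
apply: (ge0_integral_lt _ _ _ _ moo (N := box q B)).
- exact: (measurable_step c d1 b s id).
- exact: (measurable_step c d2 b s id).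
- by move=> w; exact: powR_ge0.
- move=> w; apply: ge0_ler_powR; rewrite ?nnegrE ?vnorm_ge0 ?(ltW s0)//.
  rewrite !vnorm_smx_e0 ler_wsqrtr// [leRHS]split lerDl addr_ge0//.
- by apply: (measurable_box iidZ) => p; exact: measurable_itv.
- apply: (box_gt0 iidZ) => [|p|p]; [|exact: measurable_itv|by apply: normal_prob_itv_gt0].
  by rewrite allpairs_uniq ?iota_uniq// => -[? ?] [? ?].
- move=> w Nw; apply: gt0_ltr_powR; rewrite ?nnegrE ?vnorm_ge0//.
  have Zpos i j : (i < b)%N -> j \in [:: 0%N; d1.+1] -> 0 < Z i j w.
    move=> ib jq; have := Nw (i, j); rewrite /= allpairs_f ?mem_iota// => /(_ erefl).
    by rewrite /B /= in_itv /= => /andP[].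
  have Gpos : 0 < G w d1.+1.
    rewrite /G /= sub0r sqrrN exprn_gt0// mulr_gt0//.
    rewrite (bigD1 (Ordinal b0))//=; apply: ltr_wpDr.
      by apply: sumr_ge0 => i _; rewrite mulr_ge0// ltW// Zpos ?inE ?eqxx ?orbT.
    by rewrite mulr_gt0// Zpos ?inE ?eqxx ?orbT.
  have gt : \sum_(0 <= j < d1.+1) G w j < \sum_(0 <= j < d2.+1) G w j.
    by rewrite split ltrDl ltr_wpDr.
  rewrite !vnorm_smx_e0 ltr_sqrt//; apply: le_lt_trans gt.
  by apply: sumr_ge0.
Qed.

End Monotone.

Theorem theorem4 (R : realType) (dT : measure_display) (T : measurableType dT)
  (P : probability T R) (Z : nat -> nat -> T -> R) :
  iid_std_normal P Z ->
  (* strictly increasing in the batch-size b, provided alpha >= 1 *)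
  (forall (eta var : R) (b1 b2 d : nat) (alpha1 alpha2 : R),
     0 < eta -> 0 < var -> (0 < b1)%N -> (b1 < b2)%N -> (0 < d)%N ->
     rho_negative P Z eta var b1 d -> rho_negative P Z eta var b2 d ->
     tail_index P Z eta var b1 d alpha1 -> tail_index P Z eta var b2 d alpha2 ->
     1 <= alpha1 -> alpha1 < alpha2) /\
  (* strictly decreasing in the stepsize eta, provided alpha >= 1 *)
  (forall (eta1 eta2 var : R) (b d : nat) (alpha1 alpha2 : R),
     0 < eta1 -> eta1 < eta2 -> 0 < var -> (0 < b)%N -> (0 < d)%N ->
     rho_negative P Z eta1 var b d -> rho_negative P Z eta2 var b d ->
     tail_index P Z eta1 var b d alpha1 -> tail_index P Z eta2 var b d alpha2 ->
     1 <= alpha2 -> alpha2 < alpha1) /\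
  (* strictly decreasing in the variance sigma^2, provided alpha >= 1 *)
  (forall (eta var1 var2 : R) (b d : nat) (alpha1 alpha2 : R),
     0 < eta -> 0 < var1 -> var1 < var2 -> (0 < b)%N -> (0 < d)%N ->
     rho_negative P Z eta var1 b d -> rho_negative P Z eta var2 b d ->
     tail_index P Z eta var1 b d alpha1 -> tail_index P Z eta var2 b d alpha2 ->
     1 <= alpha2 -> alpha2 < alpha1) /\
  (* strictly decreasing in the dimension d *)
  (forall (eta var : R) (b d1 d2 : nat) (alpha1 alpha2 : R),
     0 < eta -> 0 < var -> (0 < b)%N -> (0 < d1)%N -> (d1 < d2)%N ->
     rho_negative P Z eta var b d1 -> rho_negative P Z eta var b d2 ->
     tail_index P Z eta var b d1 alpha1 -> tail_index P Z eta var b d2 alpha2 ->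
     alpha2 < alpha1).
Proof.
move=> iidZ.
have cpos (eta var : R) b : 0 < eta -> 0 < var -> (0 < b)%N -> 0 < eta / b%:R * var.
  by move=> e0 v0 b0; rewrite mulr_gt0// divr_gt0// ltr0n.
split; [|split; [|split]].
- move=> eta var b1 b2 [//|d] a1 a2 e0 v0 b10 b12 _ _ _ t1 t2 a11.
  have [_ m1] := tail_index_moment iidZ (ltW v0) t1.
  have [a20 m2] := tail_index_moment iidZ (ltW v0) t2.
  (* Rewriting the scale as (eta var) / b exhibits the numerator kappa that stays fixed while b
     varies. *)
  apply: (lt_of_moment_lt1 iidZ a20 _ m2); rewrite -m1 ![eta / _ * _]mulrAC.
  apply: moment_lt_batch => //; first by rewrite mulr_gt0.
  by rewrite mulrAC m1 ltry.
- move=> eta1 eta2 var b [//|d] a1 a2 e10 e12 v0 b0 _ _ _ t1 t2 a21.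
  have [a10 m1] := tail_index_moment iidZ (ltW v0) t1.
  have [_ m2] := tail_index_moment iidZ (ltW v0) t2.
  apply: (lt_of_moment_lt1 iidZ a10 _ m1).
  (* Convexity is used at the exponent [a2] of the larger scale, which is why the bound 1 is imposed
     on that index. *)
  apply: (moment_lt_step iidZ _ _ b0 a21 m2); first exact: cpos.
  by rewrite ltr_pM2r// ltr_pM2r// invr_gt0 ltr0n.
- move=> eta var1 var2 b [//|d] a1 a2 e0 v10 v12 b0 _ _ _ t1 t2 a21.
  have [a10 m1] := tail_index_moment iidZ (ltW v10) t1.
  have [_ m2] := tail_index_moment iidZ (ltW (lt_trans v10 v12)) t2.
  apply: (lt_of_moment_lt1 iidZ a10 _ m1).
  apply: (moment_lt_step iidZ _ _ b0 a21 m2); first exact: cpos.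
  by rewrite ltr_pM2l// divr_gt0// ltr0n.
- move=> eta var b [//|d1] [//|d2] a1 a2 e0 v0 b0 _ d12 _ _ t1 t2.
  have [a10 m1] := tail_index_moment iidZ (ltW v0) t1.
  have [a20 m2] := tail_index_moment iidZ (ltW v0) t2.
  apply: (lt_of_moment_lt1 iidZ a10 _ m1); rewrite -m2.
  apply: moment_lt_dim => //; first exact: cpos.
  by rewrite m2 ltry.
Qed.
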